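(* Let $V$ be an $\mathbb{N}$-graded vertex algebra and $M$ a module for Zhu's algebra $A(V)$. Then $(S(M),Y_{S(M)})$, graded by degree, is an $\mathbb{N}$-gradable weak $V$-module.
   Context: An $\mathbb{N}$-graded vertex algebra is a vertex algebra $(V,Y,\mathbf{1})$ with $V=\coprod_{n\in\mathbb{Z}}V_{(n)}$, $V_{(n)}=0$ for $n<0$, and $[d,Y(u,x)]=x\frac{d}{dx}Y(u,x)+Y(du,x)$ where $du=nu$ for $u\in V_{(n)}$; write $\mathrm{wt}\,u=n$ for $u\in V_{(n)}$, $Y(u,x)=\sum_nu_nx^{-n-1}$, and let $L(0)=d$, so $x^{L(0)}u=x^{\mathrm{wt}\,u}u$ for homogeneous $u$. An $\mathbb{N}$-gradable weak $V$-module is a module $W=\coprod_{n\in\mathbb{N}}W_{(n)}$ for the vertex algebra $V$ such that for $u\in V_{(m)}$, $u_n=\mathrm{Res}_xx^nY_W(u,x)$ maps $W_{(j)}$ to $W_{(j+m-n-1)}$. Zhu's algebra: $O(V)$ is the span of $\mathrm{Res}_xx^nY((x+1)^{L(0)}u,x)v$ for $u,v\in V$, $n\le-2$; $A(V)=V/O(V)$ with the associative product $u*v=\mathrm{Res}_xx^{-1}Y((x+1)^{L(0)}u,x)v$. Construction of $S(M)$: let $\rho:A(V)\to\mathrm{End}\,M$ be the representation. In $V[t,t^{-1}]=V\otimes\mathbb{C}[t,t^{-1}]$ write $u(m)=u\otimes t^m$; let $T(V[t,t^{-1}])$ be its tensor algebra and consider the left $T(V[t,t^{-1}])$-module $T(V[t,t^{-1}])\otimes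 M$, spanned by $u_1(m_1)\cdots u_r(m_r)w$ ($w\in M$), of degree $\sum_i(\mathrm{wt}\,u_i-m_i-1)$ for homogeneous $u_i$ (elements of $M$ have degree $0$). Put $Y_t(u,x)=\sum_mu(m)x^{-m-1}$ and $o_t(u)=u(\mathrm{wt}\,u-1)$ for homogeneous $u$. Let $\mathcal{I}$ be the $T(V[t,t^{-1}])$-submodule generated by: (1) $u(m)w$ for homogeneous $u\in V$ and homogeneous $w\in T(V[t,t^{-1}])\otimes M$ with $\mathrm{wt}\,u-m-1+\deg w<0$; (2) $o_t(u)w-\rho(u+O(V))w$ for $u\in V$, $w\in M$; (3) $u(p)v(q)w-\sum_{i=0}^{\mathrm{wt}\,v+\deg w-q-1}\sum_{j=0}^{\mathrm{wt}\,u+\deg w}\binom{p-\mathrm{wt}\,u-\deg w}{i}\binom{\mathrm{wt}\,u+\deg w}{j}(u_{p-\mathrm{wt}\,u-\deg w-i+j}v)(q+\mathrm{wt}\,u+\deg w+i-j)w$ for homogeneous $u,v\in V$, homogeneous $w\in T(V[t,t^{-1}])\otimes M$, $p,q\in\mathbb{Z}$ with $\mathrm{wt}\,v+\deg w>q$ and $\mathrm{wt}\,u-p-1+\mathrm{wt}\,v-q-1+\deg w\ge0$. Let $S_1(M)=(T(V[t,t^{-1}])\otimes M)/\mathcal{I}$ (a graded $T(V[t,t^{-1}])$-module) with $Y_{S_1(M)}(u,x)$ induced by $Y_t(u,x)$. Let $\mathcal{J}$ be the $T(V[t,t^{-1}])$-submodule of $S_1(M)$ generated by the elements $\mathrm{Res}_{x_0}\mathrm{Res}_{x_2}x_0^{p-\mathrm{wt}\,u-\deg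 w-i}x_2^{q+i}(x_0+x_2)^{\mathrm{wt}\,u+\deg w}Y_{S_1(M)}(Y(u,x_0)v,x_2)w$, i.e. $\sum_{j=0}^{\mathrm{wt}\,u+\deg w}\binom{\mathrm{wt}\,u+\deg w}{j}(u_{p-i-j}v)(q+i+j)w$, for homogeneous $u,v\in V$, homogeneous $w\in S_1(M)$, $p,q\in\mathbb{Z}$ and integers $i\ge\mathrm{wt}\,v+\deg w-q$. Finally $S(M)=S_1(M)/\mathcal{J}$ with $Y_{S(M)}(u,x)w=\sum_m(u(m)w)x^{-m-1}$ induced by $Y_t$. *)

(* Defs.v *)
From HB Require Import structures.
From mathcomp Require Import all_boot all_order all_algebra.
From mathcomp Require Import finmap.
From mathcomp.multinomials Require Import monalg.

Set Implicit Arguments.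
Unset Strict Implicit.
Unset Printing Implicit Defensive.

Import Order.TTheory GRing.Theory Num.Theory.
Local Open Scope ring_scope.

(* generalized binomial coefficient  binom(r, i) = r(r-1)...(r-i+1)/i!
   for r an integer and i a natural number *)
Definition binz (r : int) (i : nat) : int :=
  match r with
  | Posz n => ('C(n, i))%:Z
  | Negz n => (-1) ^+ i * ('C(n + i, i))%:Z
  end.

Definition isum0 {T : zmodType} (n : int) (F : nat -> T) : T :=
  match n with
  | Posz k => \sum_(j < k.+1) F j
  | Negz _ => 0
  end.

Section Generic.
Variable K : fieldType.

Definition is_subspace (T : lmodType K) (P : T -> Prop) : Prop :=
  P 0 /\ forall (a : K) (x y : T), P x -> P y -> P (a *: x + y).

(* "sum_{i>=0} f i = sum_{i>=0} g i" in T/Z for sums that are finite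
   modulo Z: the truncated sums agree modulo Z as soon as all later terms
   lie in Z. *)
Definition fin_sum_eq_mod (T : lmodType K) (Z : T -> Prop)
    (f g : nat -> T) : Prop :=
  forall L : nat, (forall i : nat, (L <= i)%N -> Z (f i) /\ Z (g i)) ->
    Z (\sum_(i < L) f i - \sum_(i < L) g i).

Variable V : lmodType K.
Variable homV : nat -> V -> Prop.     (* homV n v  <->  v \in V_(n) *)
Variable mode : V -> int -> V -> V.   (* mode u n v = u_n v *)
Variable vac : V.

(* Borcherds identity (component form of the Jacobi identity) for an
   action Y of V on T, modulo Z:
   sum_{i>=0} binom(p,i) (u_{r+i} v)_{p+q-i} w
   = sum_{i>=0} (-1)^i binom(r,i) (u_{p+r-i} v_{q+i} w - (-1)^r v_{q+r-i} u_{p+i} w) *)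
Definition borcherds (T : lmodType K) (Z : T -> Prop)
    (Y : V -> int -> T -> T) : Prop :=
  forall (u v : V) (w : T) (p q r : int),
    fin_sum_eq_mod Z
      (fun i => (binz p i)%:~R *: Y (mode u (r + i%:Z) v) (p + q - i%:Z) w)
      (fun i => ((-1) ^+ i * (binz r i)%:~R) *:
                 (Y u (p + r - i%:Z) (Y v (q + i%:Z) w)
                  - (-1) ^+ `|r|%N *: Y v (q + r - i%:Z) (Y u (p + i%:Z) w))).

Definition NgradedVA : Prop :=
  (forall n (a : K) u u' v, mode (a *: u + u') n v = a *: mode u n v + mode u' n v) /\
  (forall n u (a : K) v v', mode u n (a *: v + v') = a *: mode u n v + mode u n v') /\
  (forall u v, exists N : int, forall n : int, N <= n -> mode u n v = 0) /\
  (forall (n : int) v, mode vac n v = if n == -1 then v else 0) /\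
  (forall u, mode u (-1) vac = u) /\
  (forall u (n : int), 0 <= n -> mode u n vac = 0) /\
  borcherds (fun x : V => x = 0) mode /\
  (forall n, is_subspace (homV n)) /\
  (forall v, exists (L : nat) (vs : nat -> V),
      (forall n, homV n (vs n)) /\ v = \sum_(n < L) vs n) /\
  (forall (L : nat) (vs : nat -> V), (forall n, homV n (vs n)) ->
      \sum_(n < L) vs n = 0 -> forall n, (n < L)%N -> vs n = 0) /\
  (* [d, Y(u,x)] = x d/dx Y(u,x) + Y(du,x), i.e. wt (u_n v) = wt u + wt v - n - 1
     (and u_n v = 0 if this is negative) *)
  (forall (a b : nat) u v (n : int), homV a u -> homV b v ->
      (a%:Z + b%:Z - n - 1 < 0 -> mode u n v = 0) /\
      (forall k : nat, k%:Z = a%:Z + b%:Z - n - 1 -> homV k (mode u n v))).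

(* Res_x x^n Y((x+1)^{L(0)} u, x) v  for u in V_(k) *)
Definition zhu_circ (k : nat) (u : V) (n : int) (v : V) : V :=
  \sum_(j < k.+1) ('C(k, j))%:R *: mode u (n + j%:Z) v.

(* u * v = Res_x x^{-1} Y((x+1)^{L(0)} u, x) v  for u in V_(k) *)
Definition zhu_star (k : nat) (u v : V) : V :=
  \sum_(j < k.+1) ('C(k, j))%:R *: mode u (j%:Z - 1) v.

Inductive OV : V -> Prop :=
| OV_gen (k : nat) (u v : V) (n : int) : homV k u -> n <= -2 -> OV (zhu_circ k u n v)
| OV_zero : OV 0
| OV_lin (a : K) (x y : V) : OV x -> OV y -> OV (a *: x + y).

(* M is a (unital) module for A(V) = V/O(V): rho is the composite of the
   representation A(V) -> End M with the projection V -> A(V). *)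
Definition Zhu_module (M : lmodType K) (rho : V -> M -> M) : Prop :=
  (forall (a : K) u u' w, rho (a *: u + u') w = a *: rho u w + rho u' w) /\
  (forall u (a : K) w w', rho u (a *: w + w') = a *: rho u w + rho u w') /\
  (forall x, OV x -> forall w, rho x w = 0) /\
  (forall w, rho vac w = w) /\
  (forall (k : nat) u v w, homV k u -> rho (zhu_star k u v) w = rho u (rho v w)).

(* N-gradable weak V-module structure on the quotient W/Z, where
   W is a vector space, Z a subspace, Y the modes (on representatives),
   and W_(d) is the image of Wg d in W/Z. *)
Definition Ngradable_weak_module (W : lmodType K) (Z : W -> Prop)
    (Y : V -> int -> W -> W) (Wg : int -> W -> Prop) : Prop :=
  is_subspace Z /\
  (forall u n f, Z f -> Z (Y u n f)) /\
  (forall n (a : K) u u' f, Z (Y (a *: u + u') n f - (a *: Y u n f + Y u' n f))) /\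
  (forall n u (a : K) f f', Z (Y u n (a *: f + f') - (a *: Y u n f + Y u n f'))) /\
  (forall u f, exists N : int, forall n : int, N <= n -> Z (Y u n f)) /\
  (forall (n : int) f, Z (Y vac n f - (if n == -1 then f else 0))) /\
  borcherds Z Y /\
  (forall d, is_subspace (Wg d)) /\
  (forall (d : int) f, d < 0 -> Wg d f -> Z f) /\
  (forall f, exists (L : nat) (fs : nat -> W),
      (forall n : nat, Wg n%:Z (fs n)) /\ Z (f - \sum_(n < L) fs n)) /\
  (forall (L : nat) (fs : nat -> W), (forall n : nat, Wg n%:Z (fs n)) ->
      Z (\sum_(n < L) fs n) -> forall n, (n < L)%N -> Z (fs n)) /\
  (forall (k : nat) u (j n : int) f, homV k u -> Wg j f ->
      Wg (j + k%:Z - n - 1) (Y u n f)).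

Variable M : lmodType K.
Variable rho : V -> M -> M.

(* a word u_1(m_1) ... u_r(m_r) w ; T(V[t,t^-1]) \otimes M is presented as
   the free vector space on words modulo multilinearity *)
Definition word := (seq (V * int) * M)%type.
Definition TM := {malg K[word]}.
Definition wd (s : seq (V * int)) (w : M) : TM := << (s, w) >>.

(* left action of u(m) = u \otimes t^m *)
Definition act (u : V) (m : int) (f : TM) : TM :=
  \sum_(x <- msupp f) f@_x *: wd ((u, m) :: x.1) x.2.

Inductive homw : seq (V * int) -> int -> Prop :=
| homw_nil : homw [::] 0
| homw_cons (k : nat) (u : V) (m : int) (s : seq (V * int)) (d : int) :
    homV k u -> homw s d -> homw ((u, m) :: s) (k%:Z - m - 1 + d).

Definition Fhom (d : int) (f : TM) : Prop :=
  forall x, x \in msupp f -> homw x.1 d.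

(* the T(V[t,t^-1])-submodule of the free space whose quotient is S(M):
   multilinearity, the generators of I, and lifts of the generators of J *)
Inductive SN : TM -> Prop :=
| SN_multM (s : seq (V * int)) (a : K) (w w' : M) :
    SN (wd s (a *: w + w') - (a *: wd s w + wd s w'))
| SN_multV (s : seq (V * int)) (a : K) (u u' : V) (m : int) (w : M) :
    SN (wd ((a *: u + u', m) :: s) w - (a *: wd ((u, m) :: s) w + wd ((u', m) :: s) w))
| SN_I1 (k : nat) (u : V) (m : int) (s : seq (V * int)) (d : int) (w : M) :
    homV k u -> homw s d -> k%:Z - m - 1 + d < 0 -> SN (wd ((u, m) :: s) w)
| SN_I2 (k : nat) (u : V) (w : M) :
    homV k u -> SN (wd [:: (u, k%:Z - 1)] w - wd [::] (rho u w))
| SN_I3 (a b : nat) (u v : V) (s : seq (V * int)) (d : int) (w : M) (p q : int) :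
    homV a u -> homV b v -> homw s d -> q < b%:Z + d ->
    0 <= a%:Z - p - 1 + b%:Z - q - 1 + d ->
    SN (wd ((u, p) :: (v, q) :: s) w -
        isum0 (b%:Z + d - q - 1) (fun i =>
          isum0 (a%:Z + d) (fun j =>
            ((binz (p - a%:Z - d) i) * (binz (a%:Z + d) j))%:~R *:
              wd ((mode u (p - a%:Z - d - i%:Z + j%:Z) v,
                   q + a%:Z + d + i%:Z - j%:Z) :: s) w)))
| SN_J (a b : nat) (u v : V) (s : seq (V * int)) (d : int) (w : M) (p q i : int) :
    homV a u -> homV b v -> homw s d -> b%:Z + d - q <= i ->
    SN (isum0 (a%:Z + d) (fun j =>
          (binz (a%:Z + d) j)%:~R *:
            wd ((mode u (p - i - j%:Z) v, q + i + j%:Z) :: s) w))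
| SN_zero : SN 0
| SN_lin (a : K) (f g : TM) : SN f -> SN g -> SN (a *: f + g)
| SN_act (u : V) (m : int) (f : TM) : SN f -> SN (act u m f).

End Generic.

(* Main.v *)
Require Import Defs.
From HB Require Import structures.
From mathcomp Require Import all_boot all_order all_algebra.
From mathcomp Require Import generic_quotient ring_quotient finmap zify ring.
From mathcomp.multinomials Require Import monalg.
From Stdlib Require Import ClassicalEpsilon.
Import Order.TTheory GRing.Theory Num.Theory.
Local Open Scope ring_scope.
Set Implicit Arguments.
Unset Strict Implicit.
Unset Printing Implicit Defensive.

(** Write [l = wt u + deg w] and [l' = wt v + deg w]. The generators (3) of I and
    those of J express, in inverted form, the weak associativity relation
    [sum_k (-1)^k binom(p,k) u_(p+l-k) v_(q+k) w = sum_j binom(l,j) (u_(p+l-j) v)_(q+j) w],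
    which is the Borcherds identity at first index [l]. Together with the vacuum
    property it gives [(a_(-k-1) 1)_m = (-1)^k binom(m,k) a_(m-k)], so that skew symmetry
    of V exchanges u and v in the Borcherds identity, which therefore also holds at
    second index [l']. The defect f of the Borcherds identity satisfies
    [f(p+1,q,r) = f(p,q+1,r) + f(p,q,r+1)]; it vanishes for [p >= l] and for [q >= l'],
    and the recursion, used downwards in p, makes it vanish everywhere.
    The sum of the homogeneous components in S(M) is direct because the homogeneous
    projections, built from those of V, preserve the relations. *)

(** * Binomial identities *)

Lemma intSr (n : nat) : n.+1%:Z = n%:Z + 1.
Proof. by rewrite -addn1. Qed.

Lemma binz0 r : binz r 0 = 1.
Proof. by case: r => n /=; rewrite bin0. Qed.

Lemma binz_nat (n i : nat) : binz n i = 'C(n, i).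
Proof. by []. Qed.

Lemma binz0S n : binz 0 n.+1 = 0.
Proof. by []. Qed.

Lemma binzS (r : int) (i : nat) : binz (r + 1) i.+1 = binz r i.+1 + binz r i.
Proof.
case: r => [n|[|n]].
- by rewrite -[n%:Z + 1]/((n + 1)%N%:Z) addn1 /= binS PoszD.
- by rewrite (_ : Negz 0 + 1 = 0) //= !add0n !binn bin0n exprS mulN1r !mulr1 addNr.
- rewrite (_ : Negz n.+1 + 1 = Negz n); last by rewrite !NegzE; lia.
  rewrite /= exprS !addSn !addnS [in RHS]binS PoszD; ring.
Qed.

Lemma binzNS (k n : nat) : (-1) ^+ n * binz (- k%:Z - 1) n = 'C(k + n, n).
Proof.
rewrite (_ : - k%:Z - 1 = Negz k); last by rewrite NegzE; lia.
by rewrite /= mulrA -exprD addnn -mul2n exprM sqrrN !expr1n mul1r.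
Qed.

(** By Pascal's rule both sides grow by [binz (p + q) n] when [p] grows by one. Hence induction on
    [n], and then on the integer [p] in both directions from [p = 0]. *)
Lemma binz_vandermonde (p q : int) (n : nat) :
  \sum_(i < n.+1) binz p i * binz q (n - i) = binz (p + q) n.
Proof.
elim: n p => [|n IH] p; first by rewrite big_ord1 !binz0.
have step (r : int) : \sum_(i < n.+2) binz (r + 1) i * binz q (n.+1 - i) =
    \sum_(i < n.+2) binz r i * binz q (n.+1 - i) + binz (r + q) n.
  rewrite -IH !(big_ord_recl n.+1) /= !binz0 -addrA; congr (_ + _).
  rewrite -big_split /=; apply: eq_bigr => i _.
  by rewrite /bump add1n subSS binzS mulrDl.
elim/int_ind: p => [|m Hm|m Hm].
- rewrite big_ord_recl big1 => [|i _]; last by rewrite lift0 binz0S mul0r.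
  by rewrite binz0 mul1r subn0 add0r addr0.
- by rewrite intSr step Hm addrAC binzS.
- apply: (addIr (binz (- m.+1%:Z + q) n)).
  rewrite -step -binzS addrAC (_ : - m.+1%:Z + 1 = - m%:Z); last by lia.
  exact: Hm.
Qed.

(** Compares coefficients of x^n in (1+x)^(p+q) (1 - x/(1+x))^p = (1+x)^q. The induction trades a
    unit of [p] for a unit of [q]. This identity collapses every double sum below. *)
Lemma binz_alt_sum (p q : int) (n : nat) :
  \sum_(i < n.+1) (-1) ^+ i * binz p i * binz (p + q - i%:Z) (n - i) = binz q n.
Proof.
elim: n p q => [|n IH] p q; first by rewrite big_ord1 !binz0.
have step (r s : int) :
    \sum_(i < n.+2) (-1) ^+ i * binz (r + 1) i * binz (r + 1 + s - i%:Z) (n.+1 - i) =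
    \sum_(i < n.+2) (-1) ^+ i * binz r i * binz (r + (s + 1) - i%:Z) (n.+1 - i) - binz s n.
  rewrite -(IH r s) !(big_ord_recl n.+1) /= !binz0 -!addrA; congr (_ + _).
    by congr (_ * binz _ _); lia.
  rewrite -sumrN -big_split /=; apply: eq_bigr => i _.
  rewrite /bump add1n subSS binzS mulrDr mulrDl; congr (_ + _).
    by congr (_ * binz _ _); lia.
  rewrite exprS mulN1r !mulNr; congr (- (_ * binz _ _)).
  by lia.
elim/int_ind: p q => [|m Hm|m Hm] q.
- rewrite big_ord_recl big1 => [|i _]; last by rewrite lift0 binz0S mulr0 mul0r.
  by rewrite binz0 mulr1 mul1r add0r addr0 subn0 subr0.
- by rewrite intSr step Hm binzS addrK.
- apply: (addIr (- binz (q - 1) n)).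
  have := step (- m.+1%:Z) (q - 1); rewrite subrK => <-.
  rewrite (_ : - m.+1%:Z + 1 = - m%:Z); last by lia.
  by rewrite Hm; have := binzS (q - 1) n; rewrite subrK => ->; rewrite addrK.
Qed.

(** * Quotient groups, finite sums and signs *)

Lemma zmod_quotient (T : zmodType) (Z : T -> Prop) :
  Z 0 -> (forall x y, Z x -> Z y -> Z (x - y)) ->
  exists (Q : zmodType) (pi : {additive T -> Q}), forall x, pi x = 0 <-> Z x.
Proof.
move=> Z0 ZB.
(* Ring quotients need a boolean predicate, so membership in [Z] is decided classically. *)
pose S : pred T := fun x => if excluded_middle_informative (Z x) then true else false.
have SP x : reflect (Z x) (x \in S).
  by rewrite unfold_in /S; case: excluded_middle_informative => h; constructor.
have SZ : zmod_closed S.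
  by split=> [|x y /SP Zx /SP Zy]; apply/SP => //; apply: ZB.
pose S' : zmodClosed T := HB.pack S (GRing.isZmodClosed.Build T S SZ).
exists (Quotient.quot S' : zmodType), (\pi_(Quotient.quot S')%qT); split.
- move=> h; apply/SP; rewrite -[x]subr0 (_ : (_ \in S) = (x - 0 \in S')) //.
  by rewrite Quotient.idealrBE h raddf0.
- move=> /SP h; rewrite -(raddf0 (\pi_(Quotient.quot S')%qT)); apply/eqP.
  by rewrite -Quotient.idealrBE subr0.
Qed.

Lemma sum_triangle (Q : zmodType) (L : nat) (g : nat -> nat -> Q) :
  \sum_(k < L) \sum_(i < L - k) g k i = \sum_(n < L) \sum_(k < n.+1) g k (n - k)%N.
Proof.
elim: L => [|L IH]; first by rewrite !big_ord0.
rewrite [RHS]big_ord_recr /= -IH big_ord_recr /= subSnn big_ord1.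
rewrite [in RHS]big_ord_recr /= subnn addrA; congr (_ + _).
rewrite -big_split /=; apply: eq_bigr => k _.
by rewrite subSn 1?ltnW // big_ord_recr.
Qed.

Lemma sum_widen0 (Q : zmodType) (m n : nat) (g : nat -> Q) : (m <= n)%N ->
  (forall i, (m <= i)%N -> g i = 0) -> \sum_(i < n) g i = \sum_(i < m) g i.
Proof.
move=> mn g0; rewrite -!(big_mkord xpredT) (big_cat_nat (n := m)) //=.
by rewrite [X in _ + X]big1_seq ?addr0 // => i /andP[_]; rewrite mem_index_iota => /andP[/g0].
Qed.

Lemma sum_eq0_from (Q : zmodType) (m n : nat) (g : nat -> Q) :
  (forall i, (m <= i)%N -> g i = 0) -> (forall i, (n <= i)%N -> g i = 0) ->
  \sum_(i < n) g i = \sum_(i < m) g i.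
Proof.
move=> gm gn; case/orP: (leq_total m n) => h; first exact: sum_widen0.
by rewrite [RHS](sum_widen0 h).
Qed.

Lemma signz_add1 (r : int) : (-1) ^+ absz (r + 1) = - (-1) ^+ `|r|%N :> int.
Proof.
case: r => [n|n]; first by rewrite -intSr /= exprS mulN1r.
by rewrite (_ : absz (Negz n) = (absz (Negz n + 1)).+1) ?exprS ?mulN1r ?opprK //; lia.
Qed.

Lemma signz_addn (r : int) (n : nat) :
  (-1) ^+ absz (r + n%:Z) = (-1) ^+ `|r|%N * (-1) ^+ n :> int.
Proof.
elim: n => [|n IH]; first by rewrite addr0 mulr1.
by rewrite intSr addrA signz_add1 IH exprS mulN1r mulrN.
Qed.

Lemma signz_sqr (r : int) : (-1) ^+ `|r|%N * (-1) ^+ `|r|%N = 1 :> int.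
Proof. by rewrite -exprD addnn -mul2n exprM sqrrN !expr1n. Qed.

(** * Borcherds identity from weak associativity *)

Section Borcherds.
Variable Q : zmodType.
Implicit Types (A B C D R : int -> int -> Q) (p q r l N : int).

(** Substituting the formula for [A] gives a double sum. On the antidiagonal [k + i = n] all terms
    share the same value of [R], and the coefficients add up to binom(0,n), so only [n = 0]
    survives. *)
Lemma associativity_inversion R A l l' :
  (forall p q, l' <= q -> R p q = 0) ->
  (forall p q (L : nat), l' - q <= L%:Z ->
    A p q = \sum_(i < L) R (p - l - i%:Z) (q + i%:Z) *~ binz (p - l) i) ->
  forall p q (L : nat), l' - q <= L%:Z ->
    \sum_(k < L) A (p + l - k%:Z) (q + k%:Z) *~ ((-1) ^+ k * binz p k) = R p q.
Proof.
move=> R0 AE p q L lL.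
pose g (k i : nat) := R (p - (k + i)%N%:Z) (q + (k + i)%N%:Z) *~
  ((-1) ^+ k * binz p k * binz (p - k%:Z) i).
transitivity (\sum_(k < L) \sum_(i < L - k) g k i).
  apply: eq_bigr => k _.
  rewrite (AE _ _ (L - k)%N); last by have := ltn_ord k; lia.
  rewrite (_ : p + l - k%:Z - l = p - k%:Z); last by ring.
  rewrite mulrz_suml; apply: eq_bigr => i _.
  by rewrite /g -mulrzA PoszD opprD !addrA [_ * (_ * _)]mulrC.
(* With [L = 0] the bound says [l' <= q], where [R] vanishes. *)
rewrite sum_triangle; case: L lL => [|L] lL.
  by rewrite big_ord0 R0 //; lia.
rewrite big_ord_recl big_ord1 big1 => [|n _].
  by rewrite /g !binz0 subr0 !addr0.
rewrite lift0 (eq_bigr (fun k : 'I_n.+2 => R (p - n.+1%:Z) (q + n.+1%:Z) *~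
  ((-1) ^+ k * binz p k * binz (p + 0 - k%:Z) (n.+1 - k)))); last first.
  by move=> k _; rewrite /g subnKC 1?addr0 // -ltnS.
by rewrite -mulrz_sumr binz_alt_sum mulr0z.
Qed.

(* [A p q], [B q p], [C r n], [D r n] stand for [u_p v_q w], [v_q u_p w], [(u_r v)_n w],
   [(v_r u)_n w]. The infinite sums of the Borcherds identity are cut at bounds that are
   correct when [C r n = 0] for [N <= r] and [A p q = 0] for [l <= q]. *)
Definition bor1 N C p q r : Q :=
  \sum_(i < `|N - r|) C (r + i%:Z) (p + q - i%:Z) *~ binz p i.

Definition bor2 l A p q r : Q :=
  \sum_(i < `|l - q|) A (p + r - i%:Z) (q + i%:Z) *~ ((-1) ^+ i * binz r i).

Lemma bor1E N C p q r (L : nat) : (forall r n, N <= r -> C r n = 0) ->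
  N - r <= L%:Z -> bor1 N C p q r = \sum_(i < L) C (r + i%:Z) (p + q - i%:Z) *~ binz p i.
Proof.
move=> C0 NL.
by apply: (sum_eq0_from (g := fun i : nat => C (r + i%:Z) (p + q - i%:Z) *~ binz p i)) => i iL;
  rewrite C0 ?mul0rz //; lia.
Qed.

Lemma bor2E l A p q r (L : nat) : (forall p q, l <= q -> A p q = 0) ->
  l - q <= L%:Z ->
  bor2 l A p q r = \sum_(i < L) A (p + r - i%:Z) (q + i%:Z) *~ ((-1) ^+ i * binz r i).
Proof.
move=> A0 lL; apply: (sum_eq0_from (g := fun i : nat =>
  A (p + r - i%:Z) (q + i%:Z) *~ ((-1) ^+ i * binz r i))) => i iL;
  by rewrite A0 ?mul0rz //; lia.
Qed.

(** Pascal's rule for binom(p+1,i). The sum at [r] is cut one term later than the one at [r + 1], so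
    that they match once the head is split off. *)
Lemma bor1_rec N C p q r : (forall r n, N <= r -> C r n = 0) ->
  bor1 N C (p + 1) q r = bor1 N C p (q + 1) r + bor1 N C p q (r + 1).
Proof.
move=> C0; rewrite !(bor1E _ _ (r := r) (L := `|N - r|.+1) C0); try lia.
rewrite (bor1E _ _ (L := `|N - r|) C0); last by lia.
rewrite !big_ord_recl !binz0 -[RHS]addrA -big_split /=.
congr (C _ _ *~ _ + _); first by ring.
apply: eq_bigr => i _; rewrite /bump add1n binzS mulrzDr.
by congr (C _ _ *~ _ + C _ _ *~ _); lia.
Qed.

Lemma bor2_rec l A p q r : (forall p q, l <= q -> A p q = 0) ->
  bor2 l A p q (r + 1) = bor2 l A (p + 1) q r - bor2 l A p (q + 1) r.
Proof.
move=> A0; rewrite !(bor2E _ _ (q := q) (L := `|l - q|.+1) A0); try lia.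
rewrite (bor2E _ _ (L := `|l - q|) A0); last by lia.
rewrite !big_ord_recl !binz0 -[RHS]addrA -sumrB /=.
congr (A _ _ *~ _ + _); first by ring.
apply: eq_bigr => i _; rewrite /bump add1n binzS mulrDr mulrzDr.
rewrite exprS mulN1r [_ * binz r i]mulNr mulrNz.
by congr (A _ _ *~ _ - A _ _ *~ _); lia.
Qed.

(** Left minus right side of the Borcherds identity, each of the three infinite sums cut at its own
    bound. *)
Definition defect N l l' A B C p q r : Q :=
  bor1 N C p q r - bor2 l' A p q r + bor2 l B q p r *~ (-1) ^+ `|r|%N.

Lemma defect_rec N l l' A B C p q r :
  (forall r n, N <= r -> C r n = 0) -> (forall p q, l' <= q -> A p q = 0) ->
  (forall q p, l <= p -> B q p = 0) ->
  defect N l l' A B C (p + 1) q r =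
    defect N l l' A B C p (q + 1) r + defect N l l' A B C p q (r + 1).
Proof.
move=> C0 A0 B0; rewrite /defect bor1_rec // !bor2_rec // signz_add1 mulrNz mulrzBl.
by rewrite [RHS]addrACA [X in _ = X + _]addrACA !opprB addKr [X in _ = _ + X]addrC subrK.
Qed.

Lemma defect_ge N l l' A B C :
  (forall r n, N <= r -> C r n = 0) -> (forall p q, l' <= q -> A p q = 0) ->
  (forall q p, l <= p -> B q p = 0) ->
  (forall q r, bor2 l' A l q r = bor1 N C l q r) ->
  forall p q r, l <= p -> defect N l l' A B C p q r = 0.
Proof.
move=> C0 A0 B0 E p q r lp; have -> : p = l + `|p - l|%N%:Z by lia.
elim: (`|p - l|%N) q r => [|k IH] q r.
  (* At [p = l] the sum over [B] is empty, and what remains is weak associativity. *)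
  by rewrite addr0 /defect E subrr add0r /bor2 subrr big_ord0 mul0rz.
by rewrite intSr addrA defect_rec // !IH addr0.
Qed.

(** [CD] is skew symmetry at the level of modes. Inserting it gives a double sum whose antidiagonals
    have the coefficients of [binz_alt_sum], which turns binom(p,n) into binom(q,n). *)
Lemma bor1_swap N C D p q r :
  (forall r n, N <= r -> C r n = 0) -> (forall r n, N <= r -> D r n = 0) ->
  (forall r m (L : nat), N - r <= L%:Z ->
    C r m = (\sum_(k < L) D (r + k%:Z) (m - k%:Z) *~ binz m k) *~ - (-1) ^+ `|r|%N) ->
  bor1 N C p q r = bor1 N D q p r *~ - (-1) ^+ `|r|%N.
Proof.
move=> C0 D0 CD; pose L := `|N - r|%N; rewrite /bor1 -/L.
pose g (i k : nat) := (D (r + (i + k)%N%:Z) (q + p - (i + k)%N%:Z) *~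
  ((-1) ^+ i * binz p i * binz (p + q - i%:Z) k)) *~ - (-1) ^+ `|r|%N.
transitivity (\sum_(i < L) \sum_(k < L - i) g i k).
  apply: eq_bigr => i _.
  rewrite (CD _ _ (L - i)%N); last by have := ltn_ord i; lia.
  rewrite signz_addn !mulrz_suml; apply: eq_bigr => k _.
  rewrite /g PoszD opprD !addrA [q + p]addrC -!mulrzA; congr (_ *~ _); ring.
rewrite sum_triangle mulrz_suml; apply: eq_bigr => n _.
rewrite -(binz_alt_sum p q) mulrz_sumr mulrz_suml; apply: eq_bigr => i _.
by rewrite /g subnKC // -ltnS.
Qed.

Lemma defect_swap N l l' A B C D p q r :
  (forall r n, N <= r -> C r n = 0) -> (forall r n, N <= r -> D r n = 0) ->
  (forall r m (L : nat), N - r <= L%:Z ->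
    C r m = (\sum_(k < L) D (r + k%:Z) (m - k%:Z) *~ binz m k) *~ - (-1) ^+ `|r|%N) ->
  defect N l l' A B C p q r = defect N l' l B A D q p r *~ - (-1) ^+ `|r|%N.
Proof.
move=> C0 D0 CD; rewrite /defect (bor1_swap _ _ _ C0 D0 CD) !mulrzDl mulNrz.
rewrite -[_ *~ _ *~ (- _)]mulrzA mulrN signz_sqr !mulrNz mulr1z opprK.
by rewrite addrAC.
Qed.

Lemma defect_eq0 N l l' A B C D p q r :
  (forall r n, N <= r -> C r n = 0) -> (forall r n, N <= r -> D r n = 0) ->
  (forall p q, l' <= q -> A p q = 0) -> (forall q p, l <= p -> B q p = 0) ->
  (forall q r, bor2 l' A l q r = bor1 N C l q r) ->
  (forall p r, bor2 l B l' p r = bor1 N D l' p r) ->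
  (forall r m (L : nat), N - r <= L%:Z ->
    C r m = (\sum_(k < L) D (r + k%:Z) (m - k%:Z) *~ binz m k) *~ - (-1) ^+ `|r|%N) ->
  defect N l l' A B C p q r = 0.
Proof.
move=> C0 D0 A0 B0 EA EB CD.
have fp := defect_ge C0 A0 B0 EA.
have fq p0 q0 r0 : l' <= q0 -> defect N l l' A B C p0 q0 r0 = 0.
  by move=> lq; rewrite (defect_swap _ _ _ _ _ _ _ C0 D0 CD) defect_ge ?mul0rz.
have [lp|lp] := lerP l p; first exact: fp.
have -> : p = l - `|p - l|%N%:Z by lia.
elim: (`|p - l|%N) q r => [|k IH] q0 r0; first by rewrite subr0 fp.
(* Since the defect vanishes at the next higher [p], the recursion trades a unit of [r] for a unit
   of [q], up to sign. Repeating this brings [q] up to [l']. *)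
have step q1 r1 : defect N l l' A B C (l - k.+1%:Z) q1 (r1 + 1) =
    - defect N l l' A B C (l - k.+1%:Z) (q1 + 1) r1.
  apply/eqP; rewrite -addr_eq0 addrC -defect_rec //.
  by rewrite (_ : l - k.+1%:Z + 1 = l - k%:Z) ?IH //; lia.
have zero m q1 r1 : l' - q1 <= m%:Z -> defect N l l' A B C (l - k.+1%:Z) q1 r1 = 0.
  elim: m q1 r1 => [|m IHm] q1 r1 h; first by rewrite fq //; lia.
  by rewrite -(subrK 1 r1) step IHm ?oppr0 //; lia.
by apply: (zero `|l' - q0|%N); lia.
Qed.

(** [E r m] stands for (u_r 1)_m and [a m] for u_m. The last hypothesis is weak associativity with
    the vacuum as second vector. It amounts to a triangular system for [E], and by [binz_alt_sum]
    the claimed values solve it too. *)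
Lemma derivative_property N (l : nat) (E : int -> int -> Q) (a : int -> Q) :
  (forall n : int, l%:Z <= n -> a n = 0) -> (forall r n, 0 <= r -> E r n = 0) ->
  0 <= N ->
  (forall q r, bor2 N (fun p q => if q == -1 then a p else 0) l q r = bor1 0 E l q r) ->
  forall (k : nat) (m : int), E (- k%:Z - 1) m = a (m - k%:Z) *~ ((-1) ^+ k * binz m k).
Proof.
move=> a0 E0 N0 WA.
have E1 (k : nat) (m : int) : \sum_(j < k.+1) E (- k%:Z - 1 + j%:Z) (m - j%:Z) *~ binz l j =
    a (m - k%:Z) *~ ((-1) ^+ k * binz (m - l%:Z) k).
  have := WA (m - l%:Z) (- k%:Z - 1).
  rewrite (bor1E _ _ (L := k.+1) E0); last by lia.
  rewrite [l%:Z + _]addrC subrK => <-.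
  have [lm|ml] := lerP l%:Z m.
    rewrite /bor2 big1 => [|i _]; last by case: eqP => [|_]; [lia|rewrite mul0rz].
    have [/a0 ->|km] := lerP l%:Z (m - k%:Z); first by rewrite mul0rz.
    have -> : m - l%:Z = `|m - l|%N by lia.
    by rewrite /= bin_small ?mulr0 ?mulr0z //; lia.
  (* The only index at which the second mode number [m - l + n] equals -1. *)
  pose n := absz (l%:Z - m - 1)%R.
  rewrite (bor2E _ _ (L := (n + `|N|).+1)); first last.
  - by lia.
  - by move=> p0 q0 Nq; case: eqP => //; lia.
  have nL : (n < (n + `|N|).+1)%N by lia.
  rewrite (bigD1 (Ordinal nL)) //= ifT; last by lia.
  rewrite big1 ?addr0 => [|i]; last first.
    rewrite -val_eqE /= => ni; case: eqP => [|_]; last by rewrite mul0rz.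
    by move: ni; lia.
  rewrite binzNS (_ : m - l%:Z = - n%:Z - 1); last by lia.
  (* Upper negation turns both coefficients into binom(n+k,k). *)
  rewrite binzNS -bin_sub ?leq_addl // addnK addnC.
  by congr (a _ *~ _); lia.
(* Only the term of index 0 in [E1] is new; the others are known by induction and cancel. *)
elim/ltn_ind=> k IH m; have := E1 k m.
rewrite -(binz_alt_sum l%:Z) mulr_sumr mulrz_sumr !big_ord_recl.
rewrite -[nat_of_ord (@ord0 k)]/0%N subr0 addr0 !binz0.
rewrite [_ + (m - _)]addrC subrK subr0 subn0 !mul1r mulr1z; set S := (X in _ + X).
rewrite (_ : S = \sum_(i < k) a (m - k%:Z) *~ ((-1) ^+ k *
  ((-1) ^+ lift ord0 i * binz l%:Z (lift ord0 i) *
    binz (m - (lift ord0 i)%:Z) (k - lift ord0 i)))); first by move/addIr.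
apply: eq_bigr => i _; rewrite lift0; have ik := ltn_ord i.
rewrite (_ : - k%:Z - 1 + i.+1%:Z = - (k - i.+1)%N%:Z - 1); last by lia.
rewrite IH; last by lia.
rewrite -mulrzA (_ : m - i.+1%:Z - _ = m - k%:Z); last by lia.
congr (_ *~ _); rewrite -[in (-1) ^+ k](subnK ik) exprD.
have : (-1) ^+ i.+1 * (-1) ^+ i.+1 = 1 :> int.
  by rewrite -exprD addnn -mul2n exprM sqrrN !expr1n.
move: ((-1) ^+ i.+1) => x xx.
rewrite -(mulrA _ x) (mulrA x) (mulrA x) xx; ring.
Qed.

End Borcherds.

(** * Linear extension from a basis, and subspaces *)

Section LinearExtension.
Variables (K : fieldType) (X : choiceType) (T : lmodType K) (h : X -> T).
Implicit Types f g : {malg K[X]}.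

Definition malg_ext f : T := \sum_(x <- msupp f) f@_x *: h x.

Lemma malg_extEw (D : {fset X}) f : (msupp f `<=` D)%fset ->
  malg_ext f = \sum_(x <- D) f@_x *: h x.
Proof.
move=> fD; apply: big_fset_incl => // x xD xf.
by rewrite mcoeff_outdom // scale0r.
Qed.

Lemma malg_ext_lin a f g : malg_ext (a *: f + g) = a *: malg_ext f + malg_ext g.
Proof.
pose D := (msupp f `|` msupp g)%fset.
rewrite !(@malg_extEw D) ?fsubsetUl ?fsubsetUr //; last first.
  apply: (fsubset_trans (msuppD_le _ _)); apply: fsetSU; exact: msuppZ_le.
rewrite scaler_sumr -big_split /=; apply: eq_bigr => x _.
by rewrite mcoeffD mcoeffZ scalerDl scalerA.
Qed.

Lemma malg_ext1 x : malg_ext << x >> = h x.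
Proof.
by rewrite /malg_ext msuppU oner_eq0 big_seq_fset1 mcoeffUU scale1r.
Qed.
End LinearExtension.

Lemma malg_ind (K : fieldType) (X : choiceType) (P : {malg K[X]} -> Prop) :
  P 0 -> (forall a f g, P f -> P g -> P (a *: f + g)) ->
  forall f, (forall x, x \in msupp f -> P << x >>) -> P f.
Proof.
move=> P0 PL f Px; rewrite [f]monalgE big_seq.
apply: (big_ind P) => // [x y Hx Hy|x xf]; first by rewrite -[x]scale1r; apply: PL.
suff -> : << f@_x *g x >> = f@_x *: << x >> + 0 by apply: PL; [apply: Px|].
by apply/malgP => y; rewrite addr0 mcoeffZ !mcoeffU mulrnAr mulr1.
Qed.

Section SubspacePredicates.
Variables (K : fieldType) (T : lmodType K) (P : T -> Prop).
Hypothesis HP : is_subspace P.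

Lemma subspaceD x y : P x -> P y -> P (x + y).
Proof. by move=> Px Py; rewrite -[x]scale1r; apply: HP.2. Qed.

Lemma subspaceZ a x : P x -> P (a *: x).
Proof. by move=> Px; rewrite -[_ *: _]addr0; apply: HP.2 => //; apply: HP.1. Qed.

Lemma subspaceB x y : P x -> P y -> P (x - y).
Proof. by move=> Px Py; rewrite addrC -scaleN1r; apply: HP.2. Qed.

Lemma subspace_sum I (r : seq I) (Q : pred I) (F : I -> T) :
  (forall i, Q i -> P (F i)) -> P (\sum_(i <- r | Q i) F i).
Proof. by move=> h; apply: (big_ind P) => //; [apply: HP.1|apply: subspaceD]. Qed.

Lemma subspace_isum0 n (F : nat -> T) : (forall i, P (F i)) -> P (isum0 n F).
Proof. by case: n => n h /=; [apply: subspace_sum|apply: HP.1]. Qed.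
End SubspacePredicates.

(** * Graded vertex algebras *)

Section GradedVertexAlgebra.
Variables (K : fieldType) (V : lmodType K) (homV : nat -> V -> Prop).
Variables (mode : V -> int -> V -> V) (vac : V).
Hypothesis HV : NgradedVA homV mode vac.

Lemma mode_linl n a u u' v : mode (a *: u + u') n v = a *: mode u n v + mode u' n v.
Proof. by case: HV => H _; apply: H. Qed.

Lemma mode_linr n a u v v' : mode u n (a *: v + v') = a *: mode u n v + mode u n v'.
Proof. by case: HV => _ [H _]; apply: H. Qed.

Lemma mode_vacl (n : int) v : mode vac n v = if n == -1 then v else 0.
Proof. by case: HV => _ [_ [_ [H _]]]; apply: H. Qed.

Lemma mode_creation u : mode u (-1) vac = u.
Proof. by case: HV => _ [_ [_ [_ [H _]]]]; apply: H. Qed.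

Lemma mode_vacr u n : 0 <= n -> mode u n vac = 0.
Proof. by case: HV => _ [_ [_ [_ [_ [H _]]]]]; apply: H. Qed.

Lemma mode_borcherds : borcherds mode (fun x : V => x = 0) mode.
Proof. by case: HV => _ [_ [_ [_ [_ [_ [H _]]]]]]. Qed.

Lemma homV_subspace n : is_subspace (homV n).
Proof. by case: HV => _ [_ [_ [_ [_ [_ [_ [H _]]]]]]]; apply: H. Qed.

Lemma homV0 n : homV n 0.
Proof. by case: (homV_subspace n). Qed.

Lemma mode_neg a b u v n : homV a u -> homV b v -> a%:Z + b%:Z - n - 1 < 0 -> mode u n v = 0.
Proof.
case: HV => _ [_ [_ [_ [_ [_ [_ [_ [_ [_ H]]]]]]]]] hu hv.
by case: (H a b u v n hu hv).
Qed.

Lemma mode_hom a b u v n k :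
  homV a u -> homV b v -> k%:Z = a%:Z + b%:Z - n - 1 -> homV k (mode u n v).
Proof.
case: HV => _ [_ [_ [_ [_ [_ [_ [_ [_ [_ H]]]]]]]]] hu hv.
by case: (H a b u v n hu hv) => _; apply.
Qed.

Lemma mode0l n v : mode 0 n v = 0.
Proof.
have := mode_linl n 1 0 0 v; rewrite !scale1r addr0 => /eqP.
by rewrite -subr_eq0 opprD addrA subrr add0r oppr_eq0 => /eqP.
Qed.

Lemma mode0r n u : mode u n 0 = 0.
Proof.
have := mode_linr n 1 u 0 0; rewrite !scale1r addr0 => /eqP.
by rewrite -subr_eq0 opprD addrA subrr add0r oppr_eq0 => /eqP.
Qed.

Lemma modeDl n u u' v : mode (u + u') n v = mode u n v + mode u' n v.
Proof. by rewrite -[u]scale1r mode_linl !scale1r. Qed.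

Lemma modeDr n u v v' : mode u n (v + v') = mode u n v + mode u n v'.
Proof. by rewrite -[v]scale1r mode_linr !scale1r. Qed.

(** * Homogeneous components of vectors *)

Lemma homV_ind (P : V -> Prop) :
  (forall u u', P u -> P u' -> P (u + u')) ->
  (forall k u, homV k u -> P u) -> forall u, P u.
Proof.
move=> PD Ph u; have P0 : P 0 by apply: Ph (homV0 0).
case: HV => _ [_ [_ [_ [_ [_ [_ [_ [H _]]]]]]]].
case: (H u) => L [vs [hvs ->]]; apply: (big_ind P) => // i _; exact: Ph.
Qed.

(** Vanishing beyond [L] makes the whole sequence, and not just its first terms, determined by
    [v]. *)
Definition decomposition (v : V) (vs : nat -> V) (L : nat) : Prop :=
  (forall n, homV n (vs n)) /\ (forall n, (L <= n)%N -> vs n = 0) /\ v = \sum_(n < L) vs n.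

Lemma decomposition_exists v : exists vsL, decomposition v vsL.1 vsL.2.
Proof.
case: HV => _ [_ [_ [_ [_ [_ [_ [_ [H _]]]]]]]]; case: (H v) => L [vs [hvs ->]].
exists (fun n => if (n < L)%N then vs n else 0, L); split=> [n|]; last split=> /= [n|].
- by rewrite /=; case: ifP => // _; apply: homV0.
- by rewrite ltnNge => ->.
- by apply: eq_bigr => i _; rewrite ltn_ord.
Qed.

(** The grading is a bare existence statement, so the components are chosen. They are unique by
    [vcomp_unique], whereas the bound [cbound] stays arbitrary. *)
Definition decomp v : (nat -> V) * nat :=
  proj1_sig (constructive_indefinite_description _ (decomposition_exists v)).
Definition vcomp v := (decomp v).1.
Definition cbound v := (decomp v).2.

Lemma decompP v : decomposition v (vcomp v) (cbound v).
Proof. by rewrite /vcomp /cbound /decomp; case: constructive_indefinite_description. Qed.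

Lemma vcomp_hom v n : homV n (vcomp v n). Proof. by case: (decompP v). Qed.

Lemma vcomp_ge v n : (cbound v <= n)%N -> vcomp v n = 0.
Proof. by case: (decompP v) => _ [H _]; apply: H. Qed.

Lemma vcomp_sum v L : (cbound v <= L)%N -> \sum_(n < L) vcomp v n = v.
Proof.
move=> vL; case: (decompP v) => _ [H E].
by rewrite [RHS]E (sum_widen0 vL).
Qed.

Lemma vcomp_unique v vs L : decomposition v vs L -> forall n, vcomp v n = vs n.
Proof.
case=> hvs [vs0 E] n; pose B := (cbound v + L + n).+1.
case: HV => _ [_ [_ [_ [_ [_ [_ [_ [_ [H _]]]]]]]]].
have := H B (fun n => vcomp v n - vs n) => /(_ _ _ n) h.
apply/eqP; rewrite -subr_eq0; apply/eqP; apply: h => [m||]; last by rewrite /B; lia.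
- by apply: (subspaceB (homV_subspace m)); [apply: vcomp_hom|].
- by rewrite sumrB vcomp_sum ?(sum_widen0 _ vs0) -?E ?subrr // /B; lia.
Qed.

Lemma vcomp_lin a u u' n : vcomp (a *: u + u') n = a *: vcomp u n + vcomp u' n.
Proof.
apply: (vcomp_unique (vs := fun n => a *: vcomp u n + vcomp u' n)
  (L := (cbound u + cbound u')%N)); split=> [m|]; last split=> [m h|].
- by apply: (homV_subspace m).2; apply: vcomp_hom.
- by rewrite !vcomp_ge ?scaler0 ?addr0 //; lia.
- by rewrite big_split /= -scaler_sumr !vcomp_sum //; lia.
Qed.

Lemma vcomp_homE k u n : homV k u -> vcomp u n = if n == k then u else 0.
Proof.
move=> hu; apply: (vcomp_unique (vs := fun n => if n == k then u else 0) (L := k.+1)).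
split=> [m|]; last split=> [m h|].
- by case: eqP => [->|_] //; apply: homV0.
- by case: eqP h => // ->; rewrite ltnn.
- rewrite big_ord_recr /= eqxx big1 ?add0r // => i _.
  by have := ltn_ord i; case: eqP => // ->; rewrite ltnn.
Qed.

(** For [v] of weight [b], splitting the vacuum in 1_(-1) v = v decomposes [v] into weights [b + i].
    By uniqueness the components of positive weight kill [v] in mode -1, and the creation property
    then makes them zero. *)
Lemma vac_hom : homV 0 vac.
Proof.
have zero n v : mode (vcomp vac n.+1) (-1) v = 0.
  elim/homV_ind: v => [v v' Hv Hv'|b v hv].
    by rewrite modeDr Hv Hv' addr0.
  pose vs k := if (b <= k)%N then mode (vcomp vac (k - b)) (-1) v else 0.
  have D : decomposition v vs (b + cbound vac).
    split=> [k|]; last split=> [k h|].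
    - rewrite /vs; case: ifP => h; last exact: homV0.
      by apply: (mode_hom (vcomp_hom _ _) hv); lia.
    - by rewrite /vs vcomp_ge ?mode0l ?if_same //; lia.
    - rewrite big_split_ord /= big1 => [|i _]; last first.
        by rewrite /vs leqNgt ltn_ord.
      rewrite add0r -{1}[v](mode_vacl (-1)) -{1}(vcomp_sum (leqnn (cbound vac))).
      rewrite (eq_bigr (fun i : 'I_(cbound vac) => mode (vcomp vac i) (-1) v)) => [|i _].
        apply: (big_rec2 (fun x y => mode x (-1) v = y)) => [|i y1 y2 _ <-].
          exact: mode0l.
        exact: modeDl.
      by rewrite /vs leq_addr addKn.
  have := vcomp_unique D (b + n.+1); rewrite (vcomp_homE _ hv) /vs leq_addr addKn => <-.
  by rewrite ifN //; lia.
rewrite -(vcomp_sum (leqnn (cbound vac))); apply: subspace_sum; first exact: homV_subspace.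
move=> [[|i] ?] _ /=; first exact: vcomp_hom.
by rewrite -[vcomp _ _]mode_creation zero; apply: homV0.
Qed.

(** * Skew symmetry in V *)

Lemma sign_scale (T : lmodType K) (n : nat) (x : T) : (-1) ^+ n *: x = x *~ (-1) ^+ n.
Proof. by rewrite -scaler_int rmorphXn rmorphN1. Qed.

(** The vector [mode x (- i - 1) vac] plays the role of the i-th divided power of the translation
    operator applied to [x]. The formula is the Borcherds identity for [v], [u] and the vacuum at
    first index -1 and second index 0. *)
Lemma skew_symmetry a b u v (r : int) (L : nat) : homV a u -> homV b v ->
  a%:Z + b%:Z - r <= L%:Z ->
  mode u r v = (\sum_(i < L) mode (mode v (r + i%:Z) u) (- i%:Z - 1) vac *~ (-1) ^+ i)
    *~ - (-1) ^+ `|r|%N.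
Proof.
move=> hu hv rL.
have v0 i : (L <= i)%N -> mode v (r + i%:Z) u = 0.
  by move=> Li; apply: (mode_neg hv hu); lia.
(* The cutoff [L.+1] keeps the term of index 0 on the right even for [L = 0]; the extra term on the
   left vanishes by [v0]. *)
have H := @mode_borcherds v u vac (-1) 0 r L.+1; rewrite /fin_sum_eq_mod in H.
lapply H; last first.
  move=> i Li; split; first by rewrite v0 ?mode0l ?scaler0 //; lia.
  by rewrite !mode_vacr ?mode0r ?scaler0 ?subr0 ?scaler0 //; lia.
move/eqP; rewrite subr_eq0 => /eqP.
rewrite big_ord_recr /= v0 // mode0l scaler0 addr0 big_ord_recl.
rewrite [X in _ = _ + X]big1 => [|i _]; last first.
  by rewrite lift0 !mode_vacr ?mode0r ?scaler0 ?subr0 ?scaler0 //; lia.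
rewrite addr0 -[nat_of_ord (@ord0 L)]/0%N binz0 mul1r scale1r !addr0 mode_vacr //.
rewrite mode0r sub0r mode_creation add0r sign_scale => E.
rewrite (eq_bigr (fun i : 'I_L => ((-1) ^+ i * ('C(0 + i, i))%:Z)%:~R *:
    mode (mode v (r + i%:Z) u) (-1 - i%:Z) vac)) => [|i _].
  by rewrite E mulrNz mulNrz opprK -mulrzA signz_sqr.
by rewrite add0n binn mulr1 scaler_int [-1 - _]addrC.
Qed.
End GradedVertexAlgebra.

(** * Rearrangement identities *)

Lemma lin_defect (K : fieldType) (T : lmodType K) (a c : K) (x x' y y' z z' : T) :
  c *: x + x' - (a *: (c *: y + y') + (c *: z + z')) =
  c *: (x - (a *: y + z)) + (x' - (a *: y' + z')).
Proof.
rewrite scalerBr !scalerDr !scalerA [c * a]mulrC [RHS]addrACA -opprD.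
by congr (_ - _); rewrite addrACA.
Qed.

(** Stated for a bare function because the action is additive in the vector of V only after
    projection to the quotient. *)
Lemma morphD_mulrz (U W : zmodType) (phi : U -> W) :
  {morph phi : x y / x + y} -> forall (c : int) x, phi (x *~ c) = phi x *~ c.
Proof.
move=> phiD c x; have phi0 : phi 0 = 0.
  by apply: (addIr (phi 0)); rewrite -phiD add0r add0r.
have nat n : phi (x *+ n) = phi x *+ n.
  by elim: n => [|n IH]; rewrite ?mulr0n // !mulrS phiD IH.
case: c => n; first by rewrite -!pmulrn.
rewrite !NegzE !mulrNz -!pmulrn; apply/eqP.
by rewrite -addr_eq0 -nat -phiD addNr phi0.
Qed.

Lemma lin_borcherds (K : fieldType) (T : lmodType K) (a c k t : K) (x x' y y' z z' : T) :
  c *: (a *: x + x') - k *: (a *: y + y' - t *: (a *: z + z')) =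
  a *: (c *: x - k *: (y - t *: z)) + (c *: x' - k *: (y' - t *: z')).
Proof.
rewrite !(scalerBr, scalerDr, scalerA, opprD, opprK) !(mulrC a).
by rewrite (mulrAC k t) [X in _ + X = _]addrACA [LHS]addrACA.
Qed.

(** * The module S(M) *)

Section WeakModule.
Variables (K : fieldType) (V : lmodType K) (homV : nat -> V -> Prop).
Variables (mode : V -> int -> V -> V) (vac : V) (M : lmodType K) (rho : V -> M -> M).
Hypothesis HV : NgradedVA homV mode vac.
Hypothesis rho_vac : forall w, rho vac w = w.

Local Notation TM := (TM V M).
Local Notation SN := (SN homV mode rho).
Local Notation wd := (@wd K V M).

(* [act] is locked because unification would otherwise compare words by unfolding their
   finitely supported functions. *)
Fact lact_key : unit. Proof. exact: tt. Qed.
Definition lact := locked_with lact_key (@act K V M).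
Local Notation act := lact.
Implicit Types (f g : TM) (s : seq (V * int)) (w : M).

Lemma SN_subspace : is_subspace SN.
Proof. by split=> [|a x y]; [apply: SN_zero|apply: SN_lin]. Qed.

Lemma lactE : lact = @Defs.act K V M.
Proof. by rewrite /lact unlock. Qed.

Lemma SN_lact u m f : SN f -> SN (act u m f).
Proof. by rewrite lactE; apply: SN_act. Qed.

Lemma act_lin u m a f g : act u m (a *: f + g) = a *: act u m f + act u m g.
Proof. rewrite lactE; exact: (malg_ext_lin (fun x : word V M => wd ((u, m) :: x.1) x.2)). Qed.

Lemma act_wd u m s w : act u m (wd s w) = wd ((u, m) :: s) w.
Proof. rewrite lactE; exact: (malg_ext1 (fun x : word V M => wd ((u, m) :: x.1) x.2)). Qed.

Lemma actD u m f g : act u m (f + g) = act u m f + act u m g.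
Proof. by rewrite -[f]scale1r act_lin !scale1r. Qed.

Lemma act0 u m : act u m 0 = 0.
Proof. by rewrite lactE /Defs.act msupp0 big_nil. Qed.

Lemma actB u m f g : act u m (f - g) = act u m f - act u m g.
Proof. by rewrite addrC -scaleN1r act_lin scaleN1r addrC. Qed.

Lemma TM_ind (P : TM -> Prop) :
  P 0 -> (forall a f g, P f -> P g -> P (a *: f + g)) ->
  (forall s w, P (wd s w)) -> forall f, P f.
Proof. by move=> P0 PL Pw f; apply: malg_ind => // -[s w] _; apply: Pw. Qed.

Lemma SN_act_lin m a u u' f :
  SN (act (a *: u + u') m f - (a *: act u m f + act u' m f)).
Proof.
elim/TM_ind: f => [|c f g Hf Hg|s w].
- by rewrite !act0 scaler0 addr0 subr0; apply: SN_zero.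
- have -> : act (a *: u + u') m (c *: f + g) -
      (a *: act u m (c *: f + g) + act u' m (c *: f + g)) =
      c *: (act (a *: u + u') m f - (a *: act u m f + act u' m f)) +
      (act (a *: u + u') m g - (a *: act u m g + act u' m g)).
    by rewrite !act_lin; apply: lin_defect.
  exact: SN_lin.
- by rewrite !act_wd; apply: SN_multV.
Qed.

Lemma SN_act0 m f : SN (act 0 m f).
Proof.
have := SN_act_lin m 1 0 0 f; rewrite !scale1r addr0 opprD addrA subrr sub0r => H.
by rewrite -[act _ _ _]opprK -scaleN1r; apply: (subspaceZ SN_subspace).
Qed.

Lemma SN_homw_neg s d w : homw homV s d -> d < 0 -> SN (wd s w).
Proof. by case=> // k u m s' d' hu hs d0; apply: SN_I1 hu hs d0. Qed.

(** Modulo [SN] every letter splits into homogeneous ones, and homogeneous words of negative degree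
    vanish. *)
Lemma TM_hom_ind (P : TM -> Prop) :
  (forall a f g, P f -> P g -> P (a *: f + g)) -> (forall f, SN f -> P f) ->
  (forall s d w, homw homV s d -> 0 <= d -> P (wd s w)) -> forall f, P f.
Proof.
move=> PL PS Pw f; apply: TM_ind => //; first by apply: PS; apply: SN_zero.
move=> {f} s w; elim: s P PL PS Pw => [|[u m] s IH] P PL PS Pw.
  by apply: (Pw _ 0) => //; constructor.
(* Quantifying over the first letter inside the predicate makes the tail homogeneous before the
   first letter is split. *)
rewrite -act_wd; apply: (IH (fun f => forall u m, P (act u m f))) => {u m s IH w}.
- by move=> a f g Hf Hg u m; rewrite act_lin; apply: PL.
- by move=> f Hf u m; apply/PS/SN_lact.
- move=> s d w hs d0 u m; elim/(homV_ind HV): u => [u u' Hu Hu'|k u hu].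
  + have {Hu Hu'} := PL 1 _ _ Hu Hu'; rewrite scale1r => H.
    have := PL 1 _ _ (PS _ (SN_act_lin m 1 u u' (wd s w))) H.
    by rewrite !scale1r subrK.
  + rewrite act_wd; have [h|h] := lerP 0 (k%:Z - m - 1 + d).
      by apply: (Pw _ (k%:Z - m - 1 + d)) => //; constructor.
    by apply: PS; apply: SN_I1 hu hs h.
Qed.

(** * Weak associativity in S(M) *)

Section Quotient.
Variables (Q : zmodType) (pi : {additive TM -> Q}).
Hypothesis piP : forall f, pi f = 0 <-> SN f.

Lemma pi_eq f g : pi f = pi g <-> SN (f - g).
Proof.
rewrite -piP raddfB; split=> [->|/eqP]; first exact: subrr.
by rewrite subr_eq0 => /eqP.
Qed.

Lemma pi_int (c : int) f : pi (c%:~R *: f) = pi f *~ c.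
Proof. by rewrite scaler_int raddfMz. Qed.

Lemma pi_act_congr u m f g : pi f = pi g -> pi (act u m f) = pi (act u m g).
Proof. by move/pi_eq => h; apply/pi_eq; rewrite -actB; apply: SN_lact. Qed.

Lemma pi_act0 m f : pi (act 0 m f) = 0.
Proof. by apply/piP; apply: SN_act0. Qed.

Lemma pi_actD m u u' f : pi (act (u + u') m f) = pi (act u m f) + pi (act u' m f).
Proof.
rewrite -raddfD; apply/pi_eq.
by have := SN_act_lin m 1 u u' f; rewrite !scale1r.
Qed.

Lemma pi_actMz m u f (c : int) : pi (act (u *~ c) m f) = pi (act u m f) *~ c.
Proof.
by apply: (morphD_mulrz (phi := fun u => pi (act u m f))) => x y; apply: pi_actD.
Qed.

Lemma pi_act_sum I (r : seq I) (P : pred I) (F : I -> V) m f :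
  pi (act (\sum_(i <- r | P i) F i) m f) = \sum_(i <- r | P i) pi (act (F i) m f).
Proof.
apply: (big_rec2 (fun x y => pi (act x m f) = y)) => [|i x y _ <-]; first exact: pi_act0.
exact: pi_actD.
Qed.

Lemma pi_mode_neg a b u v s d w (n m : int) :
  homV a u -> homV b v -> homw homV s d ->
  a%:Z - n - 1 + b%:Z - m - 1 + d < 0 -> pi (act (mode u n v) m (wd s w)) = 0.
Proof.
move=> hu hv hs h; have [k|k] := ltrP (a%:Z + b%:Z - n - 1) 0.
  by rewrite (mode_neg HV hu hv k) pi_act0.
apply/piP; rewrite act_wd.
apply: (SN_I1 mode rho w (k := absz (a%:Z + b%:Z - n - 1)%R) _ hs); last by lia.
by apply: (mode_hom HV hu hv); lia.
Qed.

Lemma pi_I1 a u s d w (m : int) : homV a u -> homw homV s d ->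
  a%:Z + d <= m -> pi (act u m (wd s w)) = 0.
Proof. by move=> hu hs h; apply/piP; rewrite act_wd; apply: (SN_I1 mode rho w hu hs); lia. Qed.

Lemma pi_mode_eq u v f (n n' m m' c c' : int) : n = n' -> m = m' -> c = c' ->
  pi (act (mode u n v) m f) *~ c = pi (act (mode u n' v) m' f) *~ c'.
Proof. by move=> -> -> ->. Qed.

(* [assoc_rhs l u v f p q] is Res_{x0} Res_{x2} x0^p x2^q (x0+x2)^l Y(Y(u,x0)v,x2)f. *)
Definition assoc_rhs (l : nat) u v f (p q : int) : Q :=
  \sum_(j < l.+1) pi (act (mode u (p + l%:Z - j%:Z) v) (q + j%:Z) f) *~ binz l j.

Section HomogeneousTriple.
Variables (a b e : nat) (u v : V) (s : seq (V * int)) (w : M).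
Hypotheses (hu : homV a u) (hv : homV b v) (hs : homw homV s e).

Lemma assoc_rhs_ge p q : (b + e)%N%:Z <= q -> assoc_rhs (a + e) u v (wd s w) p q = 0.
Proof.
(* The generator of J with its [q] set to 0 and its [i] set to the present [q]; the shift of [p]
   compensates for that [i]. *)
move=> h; have H := @SN_J _ _ _ mode _ rho a b u v s e w (p + (a + e)%N%:Z + q) 0 q hu hv hs.
lapply H => {H}; last by lia.
move=> /piP; rewrite -PoszD /= raddf_sum /= /assoc_rhs => H; rewrite -[RHS]H.
apply: eq_bigr => j _; rewrite pi_int -act_wd add0r.
by apply: pi_mode_eq => //; lia.
Qed.

(** Relation (3) of I freed of its side conditions and of its exact cutoff. Outside those conditions
    both sides vanish, by (1) together with J or with the grading of V; terms beyond the cutoff lie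
    in J. *)
Lemma associator p q (L : nat) : (b + e)%N%:Z - q <= L%:Z ->
  pi (act u p (act v q (wd s w))) =
  \sum_(i < L) assoc_rhs (a + e) u v (wd s w) (p - (a + e)%N%:Z - i%:Z) (q + i%:Z)
    *~ binz (p - (a + e)%N%:Z) i.
Proof.
move=> bL; have [qb|bq] := ltrP q (b + e)%N%:Z; last first.
  rewrite big1 => [|i _]; last by rewrite assoc_rhs_ge ?mul0rz //; lia.
  rewrite (@pi_act_congr _ _ _ 0) ?act0 ?raddf0 //; apply: (pi_I1 _ hv hs); lia.
have [deg|deg] := lerP 0 (a%:Z - p - 1 + b%:Z - q - 1 + e%:Z); last first.
  rewrite big1 => [|i _].
    rewrite act_wd; apply: (@pi_I1 a _ _ (b%:Z - q - 1 + e%:Z)) => //; last by lia.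
    exact: homw_cons.
  rewrite /assoc_rhs big1 ?mul0rz // => j _.
  by rewrite (pi_mode_neg _ hu hv hs) ?mul0rz //; lia.
have H := @SN_I3 _ _ _ mode _ rho a b u v s e w p q hu hv hs.
lapply H => {H}; last by lia.
move=> H; lapply H => {H}; last by lia.
move/pi_eq; rewrite !act_wd => ->.
pose n := absz (b%:Z + e%:Z - q - 1)%R.
rewrite -PoszD (_ : b%:Z + e%:Z - q - 1 = n%:Z) /=; last by rewrite /n; lia.
rewrite raddf_sum /=.
rewrite (sum_widen0 (m := n.+1) (g := fun i : nat => assoc_rhs (a + e) u v (wd s w)
  (p - (a + e)%N%:Z - i%:Z) (q + i%:Z) *~ binz (p - (a + e)%N%:Z) i)); first last.
- by move=> i ni; rewrite assoc_rhs_ge ?mul0rz //; rewrite /n in ni; lia.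
- by rewrite /n; lia.
(* The relation counts [j] from the opposite end of the range, hence the reversal. *)
apply: eq_bigr => i _; rewrite raddf_sum /assoc_rhs mulrz_suml (reindex_inj rev_ord_inj) /=.
apply: eq_bigr => j _; rewrite pi_int -act_wd subSS -mulrzA.
have jl : (j <= a + e)%N by rewrite -ltnS.
rewrite (bin_sub jl) [_ * binz _ _]mulrC PoszD opprD !addrA.
by apply: pi_mode_eq => //; lia.
Qed.

Lemma weak_associativity N q r :
  (forall r (n : int), N <= r -> pi (act (mode u r v) n (wd s w)) = 0) ->
  bor2 (b + e)%N (fun p q => pi (act u p (act v q (wd s w)))) (a + e)%N q r =
  bor1 N (fun r n => pi (act (mode u r v) n (wd s w))) (a + e)%N q r.
Proof.
move=> C0.
have := @associativity_inversion Q (assoc_rhs (a + e) u v (wd s w))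
  (fun p q => pi (act u p (act v q (wd s w)))) (a + e)%N (b + e)%N assoc_rhs_ge associator
  r q `|(b + e)%N%:Z - q|%N.
move=> H; lapply H => {H}; last by lia.
rewrite [r + _]addrC /bor2 => ->.
(* A cutoff beyond both the vanishing of [mode u r v] and that of the binomial coefficients; the
   latter then shortens the sum. *)
rewrite (bor1E _ _ (L := (`|N - r| + (a + e).+1)%N)) //; last by lia.
rewrite (sum_widen0 (m := (a + e).+1) (g := fun i : nat =>
  pi (act (mode u (r + i%:Z) v) ((a + e)%N%:Z + q - i%:Z) (wd s w)) *~ binz (a + e)%N i)).
- rewrite (reindex_inj rev_ord_inj) /=; apply: eq_bigr => j _; rewrite subSS.
  have jl : (j <= a + e)%N by rewrite -ltnS.
  by rewrite (bin_sub jl); apply: pi_mode_eq => //; lia.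
- by rewrite leq_addl.
- by move=> i il; rewrite /= bin_small // mulr0z.
Qed.
End HomogeneousTriple.

(** * The vacuum, derivatives and skew symmetry on S(M) *)

Lemma assoc_rhs_vac (e : nat) v f (p q : int) :
  assoc_rhs e vac v f p q =
  if 0 <= p + e%:Z + 1 then
    pi (act v (q + p + e%:Z + 1) f) *~ binz e (absz (p + e%:Z + 1)%R) else 0.
Proof.
(* Only mode -1 of the vacuum is nonzero, which singles out [j = p + e + 1]. *)
have vac0 (j : 'I_e.+1) : p + e%:Z - j%:Z != -1 ->
    pi (act (mode vac (p + e%:Z - j%:Z) v) (q + j%:Z) f) *~ binz e j = 0.
  by move=> /negPf h; rewrite (mode_vacl HV) h pi_act0 mul0rz.
have [h|h] := lerP 0 (p + e%:Z + 1); last first.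
  by rewrite /assoc_rhs big1 // => j _; apply: vac0; lia.
move En : (absz (p + e%:Z + 1)%R) => n.
have [ne|en] := leqP n e; last first.
  rewrite /assoc_rhs big1 => [|j _]; last by apply: vac0; have := ltn_ord j; lia.
  by rewrite binz_nat bin_small // mulr0z.
have ne' : (n < e.+1)%N by [].
rewrite /assoc_rhs (bigD1 (Ordinal ne')) // big1 => [|j]; last first.
  by rewrite -val_eqE => jn; apply: vac0; move: jn => /=; lia.
rewrite /= addr0.
rewrite (mode_vacl HV) ifT; last by lia.
by rewrite (_ : q + n%:Z = q + p + e%:Z + 1) //; lia.
Qed.

(** In the associator formula for the vacuum all surviving terms carry the same vector. By
    Vandermonde its coefficient is binom(p,p+1), which is 1 for [p = -1] and 0 for [p >= 0]. *)
Lemma vac_act_act b v s (e : nat) w (p q : int) : homV b v -> homw homV s e ->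
  pi (act vac p (act v q (wd s w))) = if p == -1 then pi (act v q (wd s w)) else 0.
Proof.
move=> hv hs.
pose L := (absz ((b + e)%N%:Z - q)%R + absz (p + 1)%R + 1)%N.
have H := @associator 0 b e vac v s w (vac_hom HV) hv hs p q L.
have HL : (b + e)%N%:Z - q <= L%:Z by rewrite /L; lia.
transitivity (\sum_(i < L) assoc_rhs e vac v (wd s w) (p - e%:Z - i%:Z) (q + i%:Z)
    *~ binz (p - e%:Z) i); first exact: (H HL).
move=> {H}.
have E i : assoc_rhs e vac v (wd s w) (p - e%:Z - i%:Z) (q + i%:Z) =
    if 0 <= p + 1 - i%:Z then
      pi (act v (q + p + 1) (wd s w)) *~ binz e (absz (p + 1 - i%:Z)%R) else 0.
  rewrite assoc_rhs_vac (_ : p - e%:Z - i%:Z + e%:Z + 1 = p + 1 - i%:Z); last by lia.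
  by rewrite (_ : q + i%:Z + _ + e%:Z + 1 = q + p + 1) //; lia.
have [h|h] := lerP 0 (p + 1); last first.
  rewrite ifN; last by lia.
  by rewrite big1 // => i _; rewrite E ifN ?mul0rz //; lia.
have [n En] : exists n : nat, p = n%:Z - 1 by exists (absz (p + 1)%R); lia.
rewrite (sum_widen0 (m := n.+1) (g := fun i : nat => assoc_rhs e vac v (wd s w)
  (p - e%:Z - i%:Z) (q + i%:Z) *~ binz (p - e%:Z) i)); first last.
- by move=> i ni; rewrite E ifN ?mul0rz //; lia.
- by rewrite /L; lia.
rewrite (eq_bigr (fun i : 'I_n.+1 => pi (act v (q + p + 1) (wd s w)) *~
    (binz (p - e%:Z) i * binz e (n - i)))) => [|i _]; last first.
  have := ltn_ord i => il; rewrite E ifT; last by lia.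
  rewrite -mulrzA [binz e _ * _]mulrC.
  by rewrite (_ : absz (p + 1 - i%:Z)%R = (n - i)%N) //; lia.
rewrite -mulrz_sumr binz_vandermonde subrK {}En; case: n => [|n].
  by rewrite binz0 mulr1z eqxx (_ : q + _ + 1 = q) //; lia.
rewrite intSr addrK binz_nat bin_small // mulr0z; case: eqP => //; lia.
Qed.

Lemma vac_word s d w n : homw homV s d ->
  pi (act vac n (wd s w)) = if n == -1 then pi (wd s w) else 0.
Proof.
have hvac := vac_hom HV; case=> [|k u m {}s {}d hu hs].
- have [->|n1] := eqVneq n (-1).
    by apply/pi_eq; have := SN_I2 mode rho w hvac; rewrite rho_vac act_wd.
  have [n0|n0] := lerP 0 n.
    by apply: (pi_I1 _ hvac (homw_nil homV)).
  (* For [n < -1], relation (2) writes w as 1_(-1) w, a word of length one, to which [vac_act_act]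
     applies. *)
  rewrite -[RHS](_ : pi (act vac n (act vac (-1) (wd [::] w))) = 0).
    apply: pi_act_congr; apply/esym/pi_eq.
    by have := SN_I2 mode rho w hvac; rewrite rho_vac act_wd.
  by rewrite (vac_act_act _ _ _ hvac (homw_nil homV : homw homV [::] 0%N)) (negPf n1).
- rewrite -act_wd; have [d0|d0] := ltrP d 0.
    have W0 : pi (act u m (wd s w)) = 0.
      by apply/piP; apply: SN_lact; apply: SN_homw_neg hs d0.
    by rewrite W0 if_same; apply/piP; apply: SN_lact; apply/piP.
  by case: d d0 hs => // e _ hs; apply: vac_act_act hu hs.
Qed.

Lemma pi_act_vac_act u p q s d w : homw homV s d ->
  pi (act u p (act vac q (wd s w))) = if q == -1 then pi (act u p (wd s w)) else 0.
Proof.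
move=> hs; have := vac_word w q hs; case: eqP => _ E.
  exact: pi_act_congr E.
by rewrite -[RHS](raddf0 pi) -(act0 u p); apply: pi_act_congr; rewrite E raddf0.
Qed.

(** In coefficients, the k-th divided translate of [u] acts as the k-th divided derivative of
    Y(u,x). The Borcherds identity is not yet available on S(M), so weak associativity has to yield
    this. *)
Lemma pi_mode_vac a u s (e : nat) w (k : nat) (m : int) : homV a u -> homw homV s e ->
  pi (act (mode u (- k%:Z - 1) vac) m (wd s w)) =
  pi (act u (m - k%:Z) (wd s w)) *~ ((-1) ^+ k * binz m k).
Proof.
move=> hu hs.
have E0 (r n : int) : 0 <= r -> pi (act (mode u r vac) n (wd s w)) = 0.
  by move=> r0; rewrite (mode_vacr HV) // pi_act0.
apply: (derivative_property (N := (0 + e)%N) (l := (a + e)%N)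
  (E := fun r n => pi (act (mode u r vac) n (wd s w)))
  (a := fun n => pi (act u n (wd s w)))) => //.
- by move=> n h; apply: (pi_I1 _ hu hs); lia.
- move=> q r; rewrite -(weak_associativity hu (vac_hom HV) hs) //.
  by apply: eq_bigr => i _; rewrite (pi_act_vac_act _ _ _ _ hs).
Qed.

(** Skew symmetry of V followed by the derivative formula; the two signs (-1)^k cancel. *)
Lemma pi_mode_skew a b u v s (e : nat) w (r m : int) (L : nat) :
  homV a u -> homV b v -> homw homV s e -> (a + b)%N%:Z - r <= L%:Z ->
  pi (act (mode u r v) m (wd s w)) =
  (\sum_(k < L) pi (act (mode v (r + k%:Z) u) (m - k%:Z) (wd s w)) *~ binz m k)
    *~ - (-1) ^+ `|r|%N.
Proof.
move=> hu hv hs rL; rewrite (skew_symmetry HV hu hv (L := L)); last by lia.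
rewrite pi_actMz pi_act_sum; congr (_ *~ _); apply: eq_bigr => k _; rewrite pi_actMz.
have [h|h] := ltrP (b%:Z + a%:Z - (r + k%:Z) - 1) 0.
  by rewrite (mode_neg HV hv hu h) (mode0l HV) !pi_act0 !mul0rz.
have hvu : homV (absz (b%:Z + a%:Z - (r + k%:Z) - 1)%R) (mode v (r + k%:Z) u).
  by apply: (mode_hom HV hv hu); lia.
rewrite (pi_mode_vac _ _ _ hvu hs) -mulrzA mulrAC -exprD addnn -mul2n exprM sqrrN.
by rewrite !expr1n mul1r.
Qed.

(** * The Borcherds identity on S(M) *)

Definition borcherds_term := locked_with lact_key
  (fun u v (p q r : int) (i : nat) f =>
  (binz p i)%:~R *: act (mode u (r + i%:Z) v) (p + q - i%:Z) f -
  ((-1) ^+ i * (binz r i)%:~R) *: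
    (act u (p + r - i%:Z) (act v (q + i%:Z) f)
     - (-1) ^+ `|r|%N *: act v (q + r - i%:Z) (act u (p + i%:Z) f))).

Lemma pi_borcherds_term u v p q r i f :
  pi (borcherds_term u v p q r i f) =
  pi (act (mode u (r + i%:Z) v) (p + q - i%:Z) f) *~ binz p i
  - pi (act u (p + r - i%:Z) (act v (q + i%:Z) f)) *~ ((-1) ^+ i * binz r i)
  + pi (act v (q + r - i%:Z) (act u (p + i%:Z) f)) *~ ((-1) ^+ i * binz r i)
      *~ (-1) ^+ `|r|%N.
Proof.
rewrite /borcherds_term unlock.
have -> : (-1) ^+ i * (binz r i)%:~R = ((-1) ^+ i * binz r i)%:~R :> K.
  by rewrite rmorphM rmorphXn rmorphN1.
have gen (x y z : TM) (k c t : int) : pi (k%:~R *: x - c%:~R *: (y - z *~ t)) =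
    pi x *~ k - pi y *~ c + pi z *~ c *~ t.
  rewrite raddfB 2!pi_int; rewrite raddfB; rewrite raddfMz mulrzBl opprB [_ - pi y *~ c]addrC.
  by rewrite addrA -!mulrzA [t * c]mulrC.
by rewrite sign_scale; apply: gen.
Qed.

Lemma borcherds_hom a b u v s (e : nat) w p q r (L : nat) :
  homV a u -> homV b v -> homw homV s e ->
  (a + b)%N%:Z - r <= L%:Z -> (b + e)%N%:Z - q <= L%:Z -> (a + e)%N%:Z - p <= L%:Z ->
  \sum_(i < L) pi (borcherds_term u v p q r i (wd s w)) = 0.
Proof.
move=> hu hv hs rL qL pL.
pose A p q := pi (act u p (act v q (wd s w))).
pose B q p := pi (act v q (act u p (wd s w))).
pose C r n := pi (act (mode u r v) n (wd s w)).
pose D r n := pi (act (mode v r u) n (wd s w)).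
have C0 (r0 n0 : int) : (a + b)%N%:Z <= r0 -> C r0 n0 = 0.
  by move=> h; rewrite /C (mode_neg HV hu hv) ?pi_act0 //; lia.
have D0 (r0 n0 : int) : (a + b)%N%:Z <= r0 -> D r0 n0 = 0.
  by move=> h; rewrite /D (mode_neg HV hv hu) ?pi_act0 //; lia.
have A0 (p0 q0 : int) : (b + e)%N%:Z <= q0 -> A p0 q0 = 0.
  by move=> h; apply/piP/SN_lact/piP; apply: (pi_I1 _ hv hs); lia.
have B0 (q0 p0 : int) : (a + e)%N%:Z <= p0 -> B q0 p0 = 0.
  by move=> h; apply/piP/SN_lact/piP; apply: (pi_I1 _ hu hs); lia.
(* The bounds are those at which u_r v (and v_r u), u_p w and v_q w vanish for weight reasons. *)
have := @defect_eq0 Q (a + b)%N (a + e)%N (b + e)%N A B C D p q r C0 D0 A0 B0.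
move=> H; rewrite -[RHS]H => {H}.
- rewrite /defect (bor1E _ _ C0 rL) (bor2E _ _ A0 qL) (bor2E _ _ B0 pL).
  rewrite mulrz_suml -sumrB -big_split; apply: eq_bigr => i _.
  exact: pi_borcherds_term.
- by move=> q0 r0; apply: weak_associativity.
- by move=> q0 r0; apply: weak_associativity.
- by move=> r0 m0 L0 h; apply: pi_mode_skew hu hv hs h.
Qed.

Lemma pi_act_actD v n u u' m f :
  pi (act v n (act (u + u') m f)) = pi (act v n (act u m f)) + pi (act v n (act u' m f)).
Proof.
by rewrite -raddfD -actD; apply: pi_act_congr; rewrite raddfD pi_actD.
Qed.

(** Linearity over [K] is expressed in [TM], since [Q] carries only an additive structure. *)
Lemma borcherds_term_lin u v p q r i a f g :
  borcherds_term u v p q r i (a *: f + g) =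
  a *: borcherds_term u v p q r i f + borcherds_term u v p q r i g.
Proof.
rewrite /borcherds_term unlock !act_lin.
move: (act (mode _ _ _) _ f) (act (mode _ _ _) _ g) (act u _ (act v _ f))
  (act u _ (act v _ g)) (act v _ (act u _ f)) (act v _ (act u _ g)) => x x' y y' z z'.
exact: lin_borcherds.
Qed.

Lemma borcherds_term_SN u v p q r i f : SN f -> SN (borcherds_term u v p q r i f).
Proof.
move=> Hf; have Z u' n g : SN g -> pi (act u' n g) = 0.
  by move=> Hg; apply/piP; apply: SN_lact.
by apply/piP; rewrite pi_borcherds_term !Z ?mul0rz ?subrr ?addr0 //; apply: SN_lact.
Qed.

Lemma pi_borcherds_termDl u u' v p q r i f :
  pi (borcherds_term (u + u') v p q r i f) =
  pi (borcherds_term u v p q r i f) + pi (borcherds_term u' v p q r i f).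
Proof.
rewrite !pi_borcherds_term (modeDl HV) !pi_actD pi_act_actD !mulrzDl opprD.
by rewrite [X in X + _ = _]addrACA [LHS]addrACA.
Qed.

Lemma pi_borcherds_termDr u v v' p q r i f :
  pi (borcherds_term u (v + v') p q r i f) =
  pi (borcherds_term u v p q r i f) + pi (borcherds_term u v' p q r i f).
Proof.
rewrite !pi_borcherds_term (modeDr HV) !pi_actD pi_act_actD !mulrzDl opprD.
by rewrite [X in X + _ = _]addrACA [LHS]addrACA.
Qed.

(** Homogeneous pieces have different cutoffs; vanishing for all large cutoffs is what passes to
    sums. *)
Lemma borcherds_eventually p q r f u v : exists L0 : nat, forall L, (L0 <= L)%N ->
  SN (\sum_(i < L) borcherds_term u v p q r i f).
Proof.
elim/TM_hom_ind: f u v => [a f g Hf Hg|f Hf|s d w hs d0] u v.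
- case: (Hf u v) (Hg u v) => L1 H1 [L2 H2]; exists (L1 + L2)%N => L h.
  under eq_bigr do rewrite borcherds_term_lin.
  rewrite big_split -scaler_sumr /=.
  by apply: SN_lin; [apply: H1|apply: H2]; lia.
- exists 0%N => L _; apply: (subspace_sum SN_subspace) => i _.
  exact: borcherds_term_SN.
case: d d0 hs => // e _ hs.
suff [L0 H] : exists L0 : nat, forall L, (L0 <= L)%N ->
    \sum_(i < L) pi (borcherds_term u v p q r i (wd s w)) = 0.
  by exists L0 => L h; apply/piP; rewrite raddf_sum /=; apply: H.
elim/(homV_ind HV): u v => [u u' Hu Hu'|a u hu] v.
  case: (Hu v) (Hu' v) => L1 H1 [L2 H2]; exists (L1 + L2)%N => L h.
  under eq_bigr do rewrite pi_borcherds_termDl.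
  by rewrite big_split /= H1 ?H2 ?addr0 //; lia.
elim/(homV_ind HV): v => [v v' [L1 H1] [L2 H2]|b v hv].
  exists (L1 + L2)%N => L h; under eq_bigr do rewrite pi_borcherds_termDr.
  by rewrite big_split /= H1 ?H2 ?addr0 //; lia.
exists (absz ((a + b)%N%:Z - r)%R + absz ((b + e)%N%:Z - q)%R + absz ((a + e)%N%:Z - p)%R)%N.
by move=> L h; apply: (borcherds_hom _ hu hv hs); lia.
Qed.

Lemma borcherds_SN : borcherds mode SN act.
Proof.
move=> u v f p q r L tail; have [L0 H] := borcherds_eventually p q r f u v.
rewrite -sumrB; apply/piP; rewrite raddf_sum.
transitivity (\sum_(i < L) pi (borcherds_term u v p q r i f)).
  by apply: eq_bigr => i _; rewrite /borcherds_term unlock.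
(* The given [L] may lie below [L0]; by [tail], enlarging it adds only terms of [SN]. *)
have /piP := H (L + L0)%N (leq_addl _ _); rewrite raddf_sum /= => H0.
rewrite -[RHS]H0; apply/esym.
apply: (sum_widen0 (g := fun i => pi (borcherds_term u v p q r i f))).
  exact: leq_addr.
move=> i /tail[Hl Hr]; apply/piP; rewrite /borcherds_term unlock.
exact: (subspaceB SN_subspace).
Qed.

(** * Vacuum and truncation for all elements *)

Lemma vac_SN (n : int) f : SN (act vac n f - (if n == -1 then f else 0)).
Proof.
elim/TM_hom_ind: f => [a f g Hf Hg|f Hf|s d w hs _].
- have := SN_lin a Hf Hg; rewrite act_lin; case: eqP => _; last by rewrite !subr0.
  by rewrite scalerBr opprD addrACA.
- apply: (subspaceB SN_subspace); first exact: SN_lact.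
  by case: eqP => // _; apply: SN_zero.
- by apply/pi_eq; rewrite (vac_word _ _ hs); case: eqP => // _; rewrite raddf0.
Qed.

Lemma truncation_SN u f : exists N : int, forall n, N <= n -> SN (act u n f).
Proof.
elim/TM_hom_ind: f u => [a f g Hf Hg|f Hf|s d w hs _] u.
- case: (Hf u) (Hg u) => N1 H1 [N2 H2]; exists (Num.max N1 N2) => n.
  by rewrite ge_max act_lin => /andP[h1 h2]; apply: SN_lin; [apply: H1|apply: H2].
- by exists 0 => n _; apply: SN_lact.
elim/(homV_ind HV): u => [u u' [N1 H1] [N2 H2]|a u hu].
  exists (Num.max N1 N2) => n; rewrite ge_max => /andP[h1 h2].
  apply/piP; rewrite pi_actD.
  by have /piP-> := H1 n h1; have /piP-> := H2 n h2; rewrite addr0.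
by exists (a%:Z + d) => n h; apply/piP; apply: (pi_I1 _ hu hs).
Qed.

(** * Homogeneous projections *)

Local Notation vcomp := (vcomp HV).
Local Notation cbound := (cbound HV).

(** The part of degree [d] of a word: the weight-[k] component of a letter uses up [k - x.2 - 1] of
    the degree and leaves the rest to the tail. *)
Fixpoint hword s w (d : int) : TM :=
  match s with
  | [::] => if d == 0 then wd [::] w else 0
  | x :: s' =>
      \sum_(k < cbound x.1) act (vcomp x.1 k) x.2 (hword s' w (d - (k%:Z - x.2 - 1)))
  end.

Definition hproj (d : int) : TM -> TM :=
  locked_with lact_key (malg_ext (fun x : word V M => hword x.1 x.2 d)).

Lemma hproj_lin d a f g : hproj d (a *: f + g) = a *: hproj d f + hproj d g.
Proof. rewrite /hproj unlock; exact: (malg_ext_lin (fun x : word V M => hword x.1 x.2 d)). Qed.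

Lemma hproj_wd d s w : hproj d (wd s w) = hword s w d.
Proof. rewrite /hproj unlock; exact: (malg_ext1 (fun x : word V M => hword x.1 x.2 d)). Qed.

Lemma hproj0 d : hproj d 0 = 0.
Proof. by rewrite /hproj unlock /malg_ext msupp0 big_nil. Qed.

Lemma hproj_act d u m f :
  hproj d (act u m f) =
  \sum_(k < cbound u) act (vcomp u k) m (hproj (d - (k%:Z - m - 1)) f).
Proof.
elim/TM_ind: f => [|a f g Hf Hg|s w].
- by rewrite act0 hproj0 big1 // => k _; rewrite hproj0 act0.
- rewrite act_lin hproj_lin Hf Hg scaler_sumr -big_split /=.
  by apply: eq_bigr => k _; rewrite hproj_lin act_lin.
- by rewrite act_wd hproj_wd /=; apply: eq_bigr => k _; rewrite hproj_wd.
Qed.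

(** Allows one common cutoff for several letters, whose bounds [cbound] are unrelated. *)
Lemma pi_scale_hword_cons a u m s w d L : (cbound u <= L)%N ->
  pi (a *: hword ((u, m) :: s) w d) =
  \sum_(k < L) pi (a *: act (vcomp u k) m (hword s w (d - (k%:Z - m - 1)))).
Proof.
move=> uL; rewrite /= scaler_sumr raddf_sum /=; apply/esym.
apply: (sum_widen0 (g := fun k : nat =>
  pi (a *: act (vcomp u k) m (hword s w (d - (k%:Z - m - 1)))))) => // k uk.
by rewrite vcomp_ge //; apply/piP; apply: (subspaceZ SN_subspace); apply: SN_act0.
Qed.

Lemma pi_hword_cons u m s w d L : (cbound u <= L)%N ->
  pi (hword ((u, m) :: s) w d) =
  \sum_(k < L) pi (act (vcomp u k) m (hword s w (d - (k%:Z - m - 1)))).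
Proof.
move=> uL; rewrite -[hword _ _ _]scale1r (pi_scale_hword_cons _ _ _ _ _ uL).
by apply: eq_bigr => k _; rewrite scale1r.
Qed.

Lemma pi_hword_hom s e w d : homw homV s e ->
  pi (hword s w d) = if d == e then pi (wd s w) else 0.
Proof.
move=> hs; elim: hs d => [|k u m {}s {}e hu hs IH] d.
  by rewrite /=; case: eqP => // _; rewrite raddf0.
(* When [u = 0] its bound need not exceed [k], hence the larger cutoff. *)
rewrite (pi_hword_cons _ _ _ _ (leq_addr k.+1 (cbound u))).
have kL : (k < cbound u + k.+1)%N by lia.
rewrite (bigD1 (Ordinal kL)) //= big1 => [|i]; last first.
  by rewrite -val_eqE => /negPf ik; rewrite (vcomp_homE _ _ hu) ik pi_act0.
rewrite addr0 (vcomp_homE _ _ hu) eqxx -act_wd.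
have := IH (d - (k%:Z - m - 1)).
rewrite (_ : (d - (k%:Z - m - 1) == e) = (d == k%:Z - m - 1 + e)); last by lia.
case: eqP => _ E; first exact: pi_act_congr.
by rewrite -[RHS](raddf0 pi) -(act0 u m); apply: pi_act_congr; rewrite E raddf0.
Qed.

Lemma pi_hword_zero m s w d : pi (hword ((0, m) :: s) w d) = 0.
Proof.
rewrite (pi_hword_cons _ _ _ _ (leqnn (cbound 0))) big1 // => k _.
by rewrite (vcomp_homE _ _ (homV0 HV 0)) if_same pi_act0.
Qed.

Definition graded (e : int) f : Prop :=
  forall d, SN (hproj d f - (if d == e then f else 0)).

Lemma graded_subspace e : is_subspace (graded e).
Proof.
split=> [d|a f g Hf Hg d]; first by rewrite hproj0 if_same subr0; apply: SN_zero.
have := SN_lin a (Hf d) (Hg d); rewrite hproj_lin.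
case: eqP => _; last by rewrite !subr0.
by rewrite scalerBr opprD addrACA.
Qed.

Lemma graded_word s e w : homw homV s e -> graded e (wd s w).
Proof.
move=> hs d; apply/pi_eq; rewrite hproj_wd (pi_hword_hom _ _ hs).
by case: eqP => // _; rewrite raddf0.
Qed.

(** If the expected weight of [mode u n v] is negative, this letter is 0 and no natural weight
    accounts for the degree [e]. The word then lies in [SN] and is [graded] in every degree, which
    is why homogeneity is tested modulo [SN]. *)
Lemma graded_mode a b u v s d w (n m e : int) :
  homV a u -> homV b v -> homw homV s d -> e = a%:Z - n - 1 + b%:Z - m - 1 + d ->
  graded e (wd ((mode u n v, m) :: s) w).
Proof.
move=> hu hv hs ->; have [h|h] := ltrP (a%:Z + b%:Z - n - 1) 0.
  rewrite (mode_neg HV hu hv h) => d'; apply/pi_eq; rewrite hproj_wd pi_hword_zero.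
  by case: eqP => _; rewrite ?raddf0 // -act_wd pi_act0.
rewrite (_ : _ + d = (absz (a%:Z + b%:Z - n - 1)%R)%:Z - m - 1 + d); last by lia.
by apply: graded_word; apply: homw_cons => //; apply: (mode_hom HV hu hv); lia.
Qed.

Lemma SN_hproj_graded e f d : graded e f -> SN f -> SN (hproj d f).
Proof.
move=> Hg Hf; have := subspaceD SN_subspace (Hg d) (_ : SN (if d == e then f else 0)).
by rewrite subrK; apply; case: eqP => // _; apply: SN_zero.
Qed.

Lemma pi_hword_multM s a w w' d :
  pi (hword s (a *: w + w') d) = pi (a *: hword s w d + hword s w' d).
Proof.
elim: s d => [|[u m] s IH] d.
  rewrite /=; case: eqP => _; last by rewrite scaler0 addr0.
  by apply/pi_eq; apply: SN_multM.
rewrite /= scaler_sumr -big_split /= !raddf_sum /=; apply: eq_bigr => k _.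
by rewrite -act_lin; apply: pi_act_congr.
Qed.

(** The generators of I and J are homogeneous, so modulo [SN] a projection fixes or kills them. The
    multilinearity relations are respected because [vcomp] is linear, and the action by
    [hproj_act]. *)
Lemma SN_hproj f : SN f -> forall d, SN (hproj d f).
Proof.
have hprojB d g h : hproj d (g - h) = hproj d g - hproj d h.
  by rewrite addrC -scaleN1r hproj_lin scaleN1r addrC.
have hproj_wd3 d a s1 s2 s3 w1 w2 w3 :
    hproj d (wd s1 w1 - (a *: wd s2 w2 + wd s3 w3)) =
    hword s1 w1 d - (a *: hword s2 w2 d + hword s3 w3 d).
  by rewrite hprojB hproj_lin -!hproj_wd.
elim=> {f} [s a w w'|s a u u' m w|k u m s d w hu hs h|k u w hu
  |a b u v s d w p q hu hv hs h1 h2|a b u v s d w p q i hu hv hs h|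
  |a f g _ Hf _ Hg|u m f _ Hf] e.
- rewrite hproj_wd3; apply/pi_eq; exact: pi_hword_multM.
- rewrite hproj_wd3; apply/pi_eq.
  pose L := (cbound (a *: u + u')%R + cbound u + cbound u')%N.
  have L0 : (cbound (a *: u + u')%R <= L)%N by rewrite /L; lia.
  have L1 : (cbound u <= L)%N by rewrite /L; lia.
  have L2 : (cbound u' <= L)%N by rewrite /L; lia.
  rewrite (pi_hword_cons _ _ _ _ L0) raddfD (pi_hword_cons _ _ _ _ L2).
  rewrite (pi_scale_hword_cons _ _ _ _ _ L1) -big_split /=; apply: eq_bigr => k _.
  by rewrite vcomp_lin -raddfD; apply/pi_eq; apply: SN_act_lin.
- apply: (@SN_hproj_graded (k%:Z - m - 1 + d)); last exact: SN_I1 hu hs h.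
  by apply: graded_word; apply: homw_cons.
- apply: (@SN_hproj_graded 0); last exact: SN_I2.
  apply: (subspaceB (graded_subspace 0)); apply: graded_word; last exact: homw_nil.
  have := homw_cons (k%:Z - 1) hu (homw_nil homV).
  by rewrite (_ : k%:Z - (k%:Z - 1) - 1 + 0 = 0) //; lia.
- have Hg := SN_I3 mode rho w hu hv hs h1 h2.
  apply: (@SN_hproj_graded (a%:Z - p - 1 + (b%:Z - q - 1 + d))) => //.
  apply: (subspaceB (graded_subspace _)).
    by apply: graded_word; apply: homw_cons => //; apply: homw_cons.
  apply: (subspace_isum0 (graded_subspace _)) => i.
  apply: (subspace_isum0 (graded_subspace _)) => j.
  apply: (subspaceZ (graded_subspace _)).
  by apply: (graded_mode _ hu hv hs); lia.
- have Hg := SN_J mode rho w p hu hv hs h.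
  apply: (@SN_hproj_graded (a%:Z - p - 1 + (b%:Z - q - 1 + d))) => //.
  apply: (subspace_isum0 (graded_subspace _)) => j.
  apply: (subspaceZ (graded_subspace _)).
  by apply: (graded_mode _ hu hv hs); lia.
- by rewrite hproj0; apply: SN_zero.
- by rewrite hproj_lin; apply: SN_lin.
- rewrite -lactE hproj_act; apply: (subspace_sum SN_subspace) => k _.
  by apply: SN_lact.
Qed.

(** * The grading of S(M) *)

Local Notation Fhom := (Fhom homV (M := M)).

Lemma Fhom_subspace d : is_subspace (Fhom d).
Proof.
split=> [x|a f g Hf Hg x]; first by rewrite msupp0 in_fset0.
move=> /(fsubsetP (msuppD_le _ _)); rewrite in_fsetU => /orP[|/Hg //].
by move=> /(fsubsetP (msuppZ_le _ _)) /Hf.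
Qed.

Lemma Fhom_wd s d w : homw homV s d -> Fhom d (wd s w).
Proof. by move=> hs x /(fsubsetP msuppU_le); rewrite in_fset1 => /eqP->. Qed.

Lemma Fhom_ind d (P : TM -> Prop) : is_subspace P ->
  (forall s w, homw homV s d -> P (wd s w)) -> forall f, Fhom d f -> P f.
Proof.
move=> [P0 PL] Pw f Hf; apply: malg_ind => // -[s w] /Hf; exact: Pw.
Qed.

Lemma Fhom_act k u (j n : int) f : homV k u -> Fhom j f ->
  Fhom (j + k%:Z - n - 1) (act u n f).
Proof.
move=> hu; move: f; apply: Fhom_ind => [|s w hs].
  split=> [|a f g Hf Hg]; first by rewrite act0; apply: (Fhom_subspace _).1.
  by rewrite act_lin; apply: (Fhom_subspace _).2.
rewrite act_wd (_ : j + k%:Z - n - 1 = k%:Z - n - 1 + j); last by lia.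
by apply: Fhom_wd; apply: homw_cons.
Qed.

Lemma Fhom_neg d f : d < 0 -> Fhom d f -> SN f.
Proof.
move=> d0; move: f; apply: Fhom_ind; first exact: SN_subspace.
by move=> s w hs; apply: SN_homw_neg hs d0.
Qed.

Lemma Fhom_graded d f : Fhom d f -> graded d f.
Proof.
by move: f; apply: Fhom_ind => [|s w hs]; [apply: graded_subspace|apply: graded_word].
Qed.

Lemma Fhom_independent L (fs : nat -> TM) : (forall n : nat, Fhom n%:Z (fs n)) ->
  SN (\sum_(n < L) fs n) -> forall n, (n < L)%N -> SN (fs n).
Proof.
(* Projecting the relation to degree [n] leaves only [fs n] modulo [SN]. *)
move=> hfs H n nL; have /piP := SN_hproj H n%:Z.
have -> : hproj n%:Z (\sum_(m < L) fs m) = \sum_(m < L) hproj n%:Z (fs m).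
  apply: (big_morph (hproj n%:Z)) => [x y|]; last exact: hproj0.
  by rewrite -[x]scale1r hproj_lin !scale1r.
rewrite raddf_sum /= => E; apply/piP; rewrite -[RHS]E.
rewrite (bigD1 (Ordinal nL)) //= big1 => [|m].
  by rewrite addr0; have /pi_eq := Fhom_graded (hfs n) n%:Z; rewrite eqxx.
rewrite -val_eqE eq_sym => /negPf mn.
have /pi_eq := Fhom_graded (hfs m) n%:Z; rewrite eqz_nat mn raddf0; exact.
Qed.

Lemma Fhom_decomposition f : exists (L : nat) (fs : nat -> TM),
  (forall n : nat, Fhom n%:Z (fs n)) /\ SN (f - \sum_(n < L) fs n).
Proof.
(* Vanishing beyond [L] is added to the claim so that two decompositions can be padded to a common
   length. *)
suff [L [fs [hfs [_ H]]]] : exists (L : nat) (fs : nat -> TM),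
    (forall n : nat, Fhom n%:Z (fs n)) /\ (forall n, (L <= n)%N -> fs n = 0) /\
    SN (f - \sum_(n < L) fs n) by exists L, fs.
elim/TM_hom_ind: f => [a f g [L1 [f1 [h1 [z1 H1]]]] [L2 [f2 [h2 [z2 H2]]]]|f Hf|s d w hs d0].
- exists (L1 + L2)%N, (fun n => a *: f1 n + f2 n); split=> [n|]; last split=> [n h|].
  + by apply: (Fhom_subspace _).2.
  + by rewrite z1 ?z2 ?scaler0 ?addr0 //; lia.
  + rewrite big_split /= -scaler_sumr (sum_widen0 (leq_addr L2 L1) z1).
    rewrite (sum_widen0 (leq_addl L1 L2) z2).
    by have := SN_lin a H1 H2; rewrite scalerBr addrACA -opprD.
- exists 0%N, (fun _ => 0); split=> [n|]; first exact: (Fhom_subspace _).1.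
  by split=> //; rewrite big_ord0 subr0.
- case: d d0 hs => // e _ hs.
  exists e.+1, (fun n => if n == e then wd s w else 0); split=> [n|]; last split=> [n h|].
  + by case: eqP => [->|_]; [apply: Fhom_wd|apply: (Fhom_subspace _).1].
  + by rewrite ifN //; lia.
  + rewrite big_ord_recr /= eqxx big1 => [|i _]; last first.
      by rewrite ifN //; have := ltn_ord i; lia.
    by rewrite add0r subrr; apply: SN_zero.
Qed.
End Quotient.

(** * The axioms of a gradable weak module *)

Lemma weak_module_SN :
  Ngradable_weak_module homV mode vac SN act (Fhom homV (M := M)).
Proof.
(* In [Q] congruences modulo [SN] become equations between sums; an abelian group suffices because
   the Borcherds coefficients are integers. *)
have [Q [pi piP]] := zmod_quotient (SN_zero homV mode rho) (subspaceB SN_subspace).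
split; first exact: SN_subspace.
split; first exact: SN_lact.
split; first by move=> *; apply: SN_act_lin.
split; first by move=> *; rewrite act_lin subrr; apply: SN_zero.
split; first by apply: truncation_SN piP.
split; first by apply: vac_SN piP.
split; first by apply: borcherds_SN piP.
split; first exact: Fhom_subspace.
split; first exact: Fhom_neg.
split; first by apply: Fhom_decomposition.
split; first by apply: Fhom_independent piP.
by move=> *; apply: Fhom_act.
Qed.
End WeakModule.

Theorem theorem4p1 (K : fieldType) (hK : [pchar K] =i pred0)
    (V : lmodType K) (homV : nat -> V -> Prop) (mode : V -> int -> V -> V)
    (vac : V) (M : lmodType K) (rho : V -> M -> M) :
  NgradedVA homV mode vac ->
  Zhu_module homV mode vac rho ->
  Ngradable_weak_module homV mode vac
    (SN homV mode rho) (@act K V M) (Fhom homV (M:=M)).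
Proof.
move=> HV [_ [_ [_ [rho_vac _]]]].
by rewrite -lactE; apply: weak_module_SN.
Qed.
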